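(* Let $n,d\ge 1$ be integers. The Schur algebra $S(n,d)$ over $\mathbb{Q}$ is the associative $\mathbb{Q}$-algebra (with $1$) given by generators $1_\lambda$ ($\lambda\in\Lambda(n,d)$), $e_i$, $f_i$ ($i\in\{1,\dots,n-1\}$) subject to the relations: (S1) $1_\lambda1_\mu=\delta_{\lambda,\mu}1_\lambda$ for $\lambda,\mu\in\Lambda(n,d)$, and $\sum_{\lambda\in\Lambda(n,d)}1_\lambda=1$; (S2) for all $i\in\{1,\dots,n-1\}$ and $\lambda\in\Lambda(n,d)$: $e_i1_\lambda=1_{\lambda+\alpha_i}e_i$ if $\lambda+\alpha_i\in\Lambda(n,d)$, and $e_i1_\lambda=0$ otherwise; $f_i1_\lambda=1_{\lambda-\alpha_i}f_i$ if $\lambda-\alpha_i\in\Lambda(n,d)$, and $f_i1_\lambda=0$ otherwise; $1_\lambda e_i=e_i1_{\lambda-\alpha_i}$ if $\lambda-\alpha_i\in\Lambda(n,d)$, and $1_\lambda e_i=0$ otherwise; $1_\lambda f_i=f_i1_{\lambda+\alpha_i}$ if $\lambda+\alpha_i\in\Lambda(n,d)$, and $1_\lambda f_i=0$ otherwise; (S3) $e_if_j-f_je_i=\delta_{ij}\sum_{\lambda\in\Lambda(n,d)}(\lambda_j-\lambda_{j+1})1_\lambda$ for $i,j\in\{1,\dots,n-1\}$; along with the Serre relations, for $i,j\in\{1,\dots,n-1\}$: (R4) $e_i^2e_j-2e_ie_je_i+e_je_i^2=0$ if $|i-j|=1$, and $e_ie_j-e_je_i=0$ otherwise; (R5) $f_i^2f_j-2f_if_jf_i+f_jf_i^2=0$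 if $|i-j|=1$, and $f_if_j-f_jf_i=0$ otherwise.
   Context: The Schur algebra is $S(n,d)=\operatorname{End}_{\Sigma_d}(V^{\otimes d})$, where $V=\mathbb{Q}^n$ and the symmetric group $\Sigma_d$ acts on $V^{\otimes d}$ by permuting the tensor places. $\{\varepsilon_1,\dots,\varepsilon_n\}$ is the standard basis of $\mathbb{Z}^n$ and $\alpha_i=\varepsilon_i-\varepsilon_{i+1}$ for $1\le i\le n-1$. $\Lambda(n,d)$ is the set of $\lambda\in\mathbb{N}^n$ with $\lambda_1+\cdots+\lambda_n=d$ ($\mathbb{N}$ includes $0$). In $S(n,d)$ the generators correspond to the following elements: via the action of $U(\mathfrak{gl}_n)$ on $V^{\otimes d}$ (a matrix $X$ acts as $\sum_{r=1}^d1^{\otimes(r-1)}\otimes X\otimes1^{\otimes(d-r)}$), $e_i$ and $f_i$ are the images of the matrix units $E_{i,i+1}$ and $E_{i+1,i}$, and $1_\lambda=\prod_{k=1}^n\binom{H_k}{\lambda_k}$, where $H_k$ is the image of $E_{kk}$ and $\binom{H}{m}=H(H-1)\cdots(H-m+1)/m!$. *)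

(* Defs.v *)
From HB Require Import structures.
From mathcomp Require Import all_boot all_order all_algebra perm.
From mathcomp Require Import generic_quotient boolp.
From mathcomp Require Import monalg.

Set Implicit Arguments.
Unset Strict Implicit.
Unset Printing Implicit Defensive.

Import GRing.Theory.
Local Open Scope ring_scope.
Local Open Scope quotient_scope.

Inductive two_sided_ideal (R : pzRingType) (rel : R -> R -> Prop) : R -> Prop :=
| ideal_rel l r : rel l r -> two_sided_ideal rel (l - r)
| ideal_0 : two_sided_ideal rel 0
| ideal_add x y :
    two_sided_ideal rel x -> two_sided_ideal rel y -> two_sided_ideal rel (x + y)
| ideal_mull a x : two_sided_ideal rel x -> two_sided_ideal rel (a * x)
| ideal_mulr a x : two_sided_ideal rel x -> two_sided_ideal rel (x * a).

Section QuotientAlgebra.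

Context (K : comNzRingType) (A : lalgType K) (rel : A -> A -> Prop).

Local Notation I := (two_sided_ideal rel).

Lemma ideal_opp x : I x -> I (- x).
Proof. by rewrite -mulN1r => ?; apply: ideal_mull. Qed.

Lemma ideal_scale (k : K) x : I x -> I (k *: x).
Proof. by rewrite -[k *: x]mulr_algl => ?; apply: ideal_mull. Qed.

Definition ideal_eqv (x y : A) : bool := `[< I (x - y) >].

Lemma ideal_eqv_is_equiv : equiv_class_of ideal_eqv.
Proof.
split=> [x|x y|y x z].
- by apply/asboolP; rewrite subrr; apply: ideal_0.
- by apply/asboolP/asboolP=> /ideal_opp; rewrite opprB.
- move=> /asboolP xy /asboolP yz; apply/asboolP.
  by rewrite -[x](subrK y) -addrA; apply: ideal_add.
Qed.

Canonical ideal_equiv := EquivRelPack ideal_eqv_is_equiv.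
Canonical ideal_encModRel := defaultEncModRel ideal_eqv.

(* The quotient is only given a possibly trivial ring structure, since the
   ideal generated by rel may contain 1. *)
Definition quot_alg := {eq_quot ideal_eqv}.

HB.instance Definition _ := EqQuotient.on quot_alg.
HB.instance Definition _ := Choice.on quot_alg.

Lemma quot_algP (x y : A) : reflect (I (x - y)) (x == y %[mod quot_alg]).
Proof. by rewrite piE; apply: asboolP. Qed.

Definition qzero : quot_alg := lift_cst quot_alg 0.
Definition qone : quot_alg := lift_cst quot_alg 1.
Definition qadd := lift_op2 quot_alg +%R.
Definition qopp := lift_op1 quot_alg -%R.
Definition qmul := lift_op2 quot_alg *%R.
Definition qscale (k : K) := lift_op1 quot_alg ( *:%R k).

Canonical pi_qzero_morph := PiConst qzero.
Canonical pi_qone_morph := PiConst qone.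

Lemma pi_qadd : {morph \pi : x y / x + y >-> qadd x y}.
Proof.
move=> x y; unlock qadd; apply/eqP/quot_algP.
rewrite opprD addrACA; apply: ideal_add; apply/quot_algP; by rewrite reprK.
Qed.
Canonical pi_qadd_morph := PiMorph2 pi_qadd.

Lemma pi_qopp : {morph \pi : x / - x >-> qopp x}.
Proof.
move=> x; unlock qopp; apply/eqP/quot_algP.
by rewrite -opprD; apply/ideal_opp/quot_algP; rewrite reprK.
Qed.
Canonical pi_qopp_morph := PiMorph1 pi_qopp.

Lemma pi_qmul : {morph \pi : x y / x * y >-> qmul x y}.
Proof.
move=> x y; unlock qmul; apply/eqP/quot_algP.
set x' := repr _; set y' := repr _.
have -> : x * y - x' * y' = (x - x') * y + x' * (y - y').
  by rewrite mulrBl mulrBr addrA subrK.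
apply: ideal_add; [apply: ideal_mulr | apply: ideal_mull];
  by apply/quot_algP; rewrite reprK.
Qed.
Canonical pi_qmul_morph := PiMorph2 pi_qmul.

Lemma pi_qscale k : {morph \pi : x / k *: x >-> qscale k x}.
Proof.
move=> x; unlock qscale; apply/eqP/quot_algP.
by rewrite -scalerBr; apply/ideal_scale/quot_algP; rewrite reprK.
Qed.
Canonical pi_qscale_morph k := PiMorph1 (pi_qscale k).

Fact qaddA : associative qadd.
Proof. by elim/quotW=> x; elim/quotW=> y; elim/quotW=> z; rewrite !piE addrA. Qed.
Fact qaddC : commutative qadd.
Proof. by elim/quotW=> x; elim/quotW=> y; rewrite !piE addrC. Qed.
Fact qadd0 : left_id qzero qadd.
Proof. by elim/quotW=> x; rewrite !piE add0r. Qed.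
Fact qaddN : left_inverse qzero qopp qadd.
Proof. by elim/quotW=> x; rewrite !piE addNr. Qed.
HB.instance Definition _ :=
  GRing.isZmodule.Build quot_alg qaddA qaddC qadd0 qaddN.

Fact qmulA : associative qmul.
Proof. by elim/quotW=> x; elim/quotW=> y; elim/quotW=> z; rewrite !piE mulrA. Qed.
Fact qmul1l : left_id qone qmul.
Proof. by elim/quotW=> x; rewrite !piE mul1r. Qed.
Fact qmul1r : right_id qone qmul.
Proof. by elim/quotW=> x; rewrite !piE mulr1. Qed.
Fact qmulDl : left_distributive qmul qadd.
Proof. by elim/quotW=> x; elim/quotW=> y; elim/quotW=> z; rewrite !piE mulrDl. Qed.
Fact qmulDr : right_distributive qmul qadd.
Proof. by elim/quotW=> x; elim/quotW=> y; elim/quotW=> z; rewrite !piE mulrDr. Qed.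
HB.instance Definition _ :=
  GRing.Zmodule_isPzRing.Build quot_alg qmulA qmul1l qmul1r qmulDl qmulDr.

Fact qscaleA a b x : qscale a (qscale b x) = qscale (a * b) x.
Proof. by elim/quotW: x => x; rewrite !piE scalerA. Qed.
Fact qscale1 : left_id 1 qscale.
Proof. by elim/quotW=> x; rewrite !piE scale1r. Qed.
Fact qscaleDr : right_distributive qscale +%R.
Proof. by move=> k; elim/quotW=> x; elim/quotW=> y; rewrite !piE scalerDr. Qed.
Fact qscaleDl x : {morph qscale^~ x : a b / a + b}.
Proof. by elim/quotW: x => x a b; rewrite !piE scalerDl. Qed.
HB.instance Definition _ :=
  GRing.Zmodule_isLmodule.Build K quot_alg qscaleA qscale1 qscaleDr qscaleDl.

Definition quot_pi (x : A) : quot_alg := \pi_quot_alg x.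

Lemma quot_piP (x y : A) : quot_pi x = quot_pi y <-> I (x - y).
Proof. by split=> [/eqP/quot_algP | /quot_algP/eqP]. Qed.

Lemma quot_pi_surj (q : quot_alg) : exists x, quot_pi x = q.
Proof. by elim/quotW: q => x; exists x. Qed.

Fact quot_pi_is_zmod_morphism : zmod_morphism quot_pi.
Proof. by move=> x y; rewrite /quot_pi !piE. Qed.
HB.instance Definition _ :=
  GRing.isZmodMorphism.Build A quot_alg quot_pi quot_pi_is_zmod_morphism.
Fact quot_pi_is_monoid_morphism : monoid_morphism quot_pi.
Proof. by split=> [|x y]; rewrite /quot_pi !piE. Qed.
HB.instance Definition _ :=
  GRing.isMonoidMorphism.Build A quot_alg quot_pi quot_pi_is_monoid_morphism.
Fact quot_pi_is_scalable : scalable quot_pi.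
Proof. by move=> k x; apply: pi_qscale. Qed.
HB.instance Definition _ :=
  GRing.isScalable.Build K A quot_alg *:%R quot_pi quot_pi_is_scalable.

End QuotientAlgebra.

Definition free_alg (X : choiceType) := {malg rat[{fmonom X}]}.

HB.instance Definition _ X := GRing.Lalgebra.on (free_alg X).

Definition letter (X : choiceType) (x : X) : free_alg X := << fmu x >>.

(* (Q^n)^{(x) d} in coordinates: t w is the coefficient of the basis tensor
   v_{w 0} (x) ... (x) v_{w (d-1)}, so that x_0 (x) ... (x) x_{d-1} is the
   function w |-> \prod_r (x_r)_{w r}. *)
Definition tensor (n d : nat) := {ffun {ffun 'I_d -> 'I_n} -> rat^o}.

HB.instance Definition _ n d := Vector.on (tensor n d).

Definition tensor_end (n d : nat) := 'End(tensor n d).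

HB.instance Definition _ n d := Vector.on (tensor_end n d).
(* The product is f * g = f \o g, with endomorphisms acting on the left; note
   that the product on 'End(_) provided by FalgLfun is the opposite one. *)
HB.instance Definition _ n d := GRing.Zmodule_isPzRing.Build (tensor_end n d)
  (@comp_lfunA _ _ _ _ _) (@comp_lfun1l _ _ _) (@comp_lfun1r _ _ _)
  (@comp_lfunDl _ _ _ _) (@comp_lfunDr _ _ _ _).

Section SchurAlgebra.

Context (n d : nat).

Definition place_perm (s : 'S_d) (t : tensor n d) : tensor n d :=
  [ffun w : {ffun 'I_d -> 'I_n} => t [ffun r => w (s r)]].

Fact place_perm_is_linear s : linear (place_perm s).
Proof. by move=> k t u; apply/ffunP=> w; rewrite !ffunE. Qed.
HB.instance Definition _ s := GRing.isLinear.Build rat (tensor n d) (tensor n d)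
  *:%R (place_perm s) (place_perm_is_linear s).

Definition place_perm_end (s : 'S_d) : tensor_end n d := linfun (place_perm s).

Definition schur_pred : {pred tensor_end n d} :=
  [pred f | [forall s, f * place_perm_end s == place_perm_end s * f]].

Lemma schur_predP f :
  reflect (forall s, f * place_perm_end s = place_perm_end s * f)
          (f \in schur_pred).
Proof. by apply: (iffP forallP) => h s; apply/eqP. Qed.

Fact schur_subring_closed : subring_closed schur_pred.
Proof.
split=> [|f g|f g].
- by apply/schur_predP=> s; rewrite mul1r mulr1.
- move=> /schur_predP hf /schur_predP hg; apply/schur_predP=> s.
  by rewrite mulrBl mulrBr hf hg.
- move=> /schur_predP hf /schur_predP hg; apply/schur_predP=> s.
  by rewrite -mulrA hg mulrA hf mulrA.
Qed.
HB.instance Definition _ :=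
  GRing.isSubringClosed.Build (tensor_end n d) schur_pred schur_subring_closed.

Fact schur_scaler_closed : GRing.scaler_closed schur_pred.
Proof.
move=> k f /schur_predP hf; apply/schur_predP=> s.
by have := congr1 ( *:%R k) (hf s); rewrite /GRing.mul /= comp_lfunZl comp_lfunZr.
Qed.
HB.instance Definition _ :=
  GRing.isScaleClosed.Build rat (tensor_end n d) schur_pred schur_scaler_closed.

Record schur : predArgType :=
  Schur { schur_val : tensor_end n d; schur_valP : schur_val \in schur_pred }.

HB.instance Definition _ := [isSub for schur_val].
HB.instance Definition _ := [Choice of schur by <:].
HB.instance Definition _ := [SubChoice_isSubZmodule of schur by <:].
HB.instance Definition _ := GRing.SubZmodule_isSubPzRing.Build _ _ schur
  (subringClosedP _).
HB.instance Definition _ := [SubZmodule_isSubLmodule of schur by <:].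

(* M_0 (x) ... (x) M_{d-1}, the matrices acting on column vectors. *)
Definition tensor_map (M : 'I_d -> 'M[rat]_n) (t : tensor n d) : tensor n d :=
  [ffun w : {ffun 'I_d -> 'I_n} =>
     \sum_(u : {ffun 'I_d -> 'I_n}) (\prod_r M r (w r) (u r)) * t u].

Fact tensor_map_is_linear M : linear (tensor_map M).
Proof.
move=> k t u; apply/ffunP=> w; rewrite !ffunE scaler_sumr -big_split /=.
by apply: eq_bigr => v _; rewrite !ffunE mulrDr /GRing.scale /= mulrCA.
Qed.
HB.instance Definition _ M := GRing.isLinear.Build rat (tensor n d) (tensor n d)
  *:%R (tensor_map M) (tensor_map_is_linear M).

Definition gl_act (X : 'M[rat]_n) : tensor_end n d :=
  \sum_(r < d) linfun (tensor_map (fun s => if s == r then X else 1%:M)).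

Definition end_binomial (H : tensor_end n d) (m : nat) : tensor_end n d :=
  (m`!%:R^-1 : rat) *: \prod_(j < m) (H - j%:R).

(* Lambda(n,d): bounding the parts by d loses nothing and makes it finite. *)
Definition weight :=
  {lam : {ffun 'I_n -> 'I_d.+1} | (\sum_k lam k == d)%N}.

Definition part (lam : weight) (k : 'I_n) : nat := val lam k.

Definition weight_vec (lam : weight) : 'rV[int]_n := \row_k (part lam k)%:Z.

End SchurAlgebra.

(* An index i : 'I_n.-1 stands for the simple root number i + 1; lo i and hi i
   are the two consecutive positions it involves. *)
Definition lo (n : nat) (i : 'I_n.-1) : 'I_n := widen_ord (leq_pred n) i.

Fact hi_subproof (n : nat) (i : 'I_n.-1) : (i.+1 < n)%N.
Proof. by case: n i => [|n] i; [case: i | exact: ltn_ord]. Qed.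

Definition hi (n : nat) (i : 'I_n.-1) : 'I_n := Ordinal (hi_subproof i).

Definition simple_root (n : nat) (i : 'I_n.-1) : 'rV[int]_n :=
  delta_mx 0 (lo i) - delta_mx 0 (hi i).

Inductive generator (n d : nat) :=
| Gen1 of weight n d
| GenE of 'I_n.-1
| GenF of 'I_n.-1.

Section GeneratorChoice.
Context (n d : nat).

Definition generator_code (g : generator n d) :
    (weight n d + ('I_n.-1 + 'I_n.-1))%type :=
  match g with
  | Gen1 lam => inl lam | GenE i => inr (inl i) | GenF i => inr (inr i)
  end.

Definition generator_decode (c : (weight n d + ('I_n.-1 + 'I_n.-1))%type) :
    generator n d :=
  match c with
  | inl lam => Gen1 lam | inr (inl i) => GenE _ i | inr (inr i) => GenF _ i
  end.

Lemma generator_codeK : cancel generator_code generator_decode.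
Proof. by case. Qed.

HB.instance Definition _ :=
  Choice.copy (generator n d) (can_type generator_codeK).

End GeneratorChoice.

Section Presentation.

Context (n d : nat).

Local Notation A := (free_alg (generator n d)).
Local Notation wt := (@weight_vec n d).
Local Notation alpha := (@simple_root n).

Definition free_1 (lam : weight n d) : A := letter (Gen1 lam).
Definition free_e (i : 'I_n.-1) : A := letter (GenE d i).
Definition free_f (i : 'I_n.-1) : A := letter (GenF d i).

Local Notation idem := free_1.
Local Notation e := free_e.
Local Notation f := free_f.

Definition adjacent (i j : 'I_n.-1) : bool := `|i%:Z - j%:Z| == 1.

Inductive schur_rel : A -> A -> Prop :=
| rel_idem_orthogonal lam mu :
    schur_rel (idem lam * idem mu) (if lam == mu then idem lam else 0)
| rel_idem_complete : schur_rel (\sum_lam idem lam) 1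
| rel_e_idem i lam mu :
    wt mu = wt lam + alpha i -> schur_rel (e i * idem lam) (idem mu * e i)
| rel_e_idem0 i lam :
    (forall mu, wt mu <> wt lam + alpha i) -> schur_rel (e i * idem lam) 0
| rel_f_idem i lam mu :
    wt mu = wt lam - alpha i -> schur_rel (f i * idem lam) (idem mu * f i)
| rel_f_idem0 i lam :
    (forall mu, wt mu <> wt lam - alpha i) -> schur_rel (f i * idem lam) 0
| rel_idem_e i lam mu :
    wt mu = wt lam - alpha i -> schur_rel (idem lam * e i) (e i * idem mu)
| rel_idem_e0 i lam :
    (forall mu, wt mu <> wt lam - alpha i) -> schur_rel (idem lam * e i) 0
| rel_idem_f i lam mu :
    wt mu = wt lam + alpha i -> schur_rel (idem lam * f i) (f i * idem mu)
| rel_idem_f0 i lam :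
    (forall mu, wt mu <> wt lam + alpha i) -> schur_rel (idem lam * f i) 0
| rel_commutator i j :
    schur_rel (e i * f j - f j * e i)
      (if i == j then
         \sum_lam ((part lam (lo j))%:R - (part lam (hi j))%:R : rat) *: idem lam
       else 0)
| rel_e_serre i j : adjacent i j ->
    schur_rel (e i ^+ 2 * e j - 2 *: (e i * e j * e i) + e j * e i ^+ 2) 0
| rel_e_commute i j : ~~ adjacent i j -> schur_rel (e i * e j - e j * e i) 0
| rel_f_serre i j : adjacent i j ->
    schur_rel (f i ^+ 2 * f j - 2 *: (f i * f j * f i) + f j * f i ^+ 2) 0
| rel_f_commute i j : ~~ adjacent i j -> schur_rel (f i * f j - f j * f i) 0.

Definition presented_alg := quot_alg schur_rel.

HB.instance Definition _ := GRing.PzRing.on presented_alg.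
HB.instance Definition _ := GRing.Lmodule.on presented_alg.

Definition gen_class (g : generator n d) : presented_alg :=
  quot_pi schur_rel (letter g).

Definition gen_end (g : generator n d) : tensor_end n d :=
  match g with
  | Gen1 lam => \prod_(k < n) end_binomial (gl_act d (delta_mx k k)) (part lam k)
  | GenE i => gl_act d (delta_mx (lo i) (hi i))
  | GenF i => gl_act d (delta_mx (hi i) (lo i))
  end.

End Presentation.

(* Main.v *)
From HB Require Import structures.
Require Import Defs.
From mathcomp Require Import all_boot all_order all_algebra perm zify.
From mathcomp Require Import generic_quotient finmap monalg.

(* The proof compares the presented algebra P with S(n,d) through normally
   ordered products.  The Serre relations yield elements E i j of P satisfying
   the commutation relations of gl_n.  For a word w of matrix units let N w be
   the corresponding normally ordered product: N is symmetric in the letters,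
   E i j * N w = N ((i, j) :: w) + (sum over the letters (j, l) of w replaced by
   (i, l)), and in S(n,d) it is the sum over all ways to put the letters of w in
   distinct tensor places.
   - In P, N w = 0 for words of length d + 1: for diagonal words because the
     weights have sum d, and in general because the bracket with E i j trades a
     diagonal letter for an off-diagonal one.
   - Since the E i i sum up to d, it follows that the N w with w of length d
     span a left ideal containing 1, that is, all of P.
   - In S(n,d) the N w with w of length d, one for each multiset of letters, are
     nonzero multiples of the standard basis of the symmetric group invariants
     of End(V)^{(x) d}.
   Hence P -> S(n,d) maps a spanning family onto a basis. *)

Set Implicit Arguments.
Unset Strict Implicit.
Unset Printing Implicit Defensive.

Import GRing.Theory.
Local Open Scope ring_scope.


(** * Linear identities in abelian groups *)

Inductive zexpr :=
  ZVar of nat | ZZero | ZAdd of zexpr & zexpr | ZOpp of zexpr.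

Section AbelianIdentities.

Context (V : zmodType).

Fixpoint zeval (env : seq V) (t : zexpr) : V :=
  match t with
  | ZVar i => env`_i
  | ZZero => 0
  | ZAdd t u => zeval env t + zeval env u
  | ZOpp t => - zeval env t
  end.

Fixpoint zcoef (t : zexpr) (i : nat) : int :=
  match t with
  | ZVar j => (i == j)%:R
  | ZZero => 0
  | ZAdd t u => zcoef t i + zcoef u i
  | ZOpp t => - zcoef t i
  end.

(** A term counts only through its integer coefficients; variables beyond [env] read the default 0,
    so the sum can stop at [size env]. *)
Lemma zevalE env t : zeval env t = \sum_(i < size env) env`_i *~ zcoef t i.
Proof.
elim: t => [j||t IHt u IHu|t IHt] /=.
- have [lt_j|ge_j] := ltnP j (size env); last first.
    rewrite nth_default // big1 // => i _.
    by rewrite eqn_leq [(j <= _)%N]leqNgt (leq_trans (ltn_ord i)) // andbF.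
  rewrite (bigD1 (Ordinal lt_j)) //= eqxx big1 ?addr0 // => i neq_ij.
  by have -> : (i == j :> nat) = false by apply: contraNF neq_ij => /eqP ij; apply/eqP/val_inj.
- by rewrite big1 // => i _; rewrite mulr0z.
- by rewrite IHt IHu -big_split /=; apply: eq_bigr => i _; rewrite mulrzDr.
- by rewrite IHt -sumrN; apply: eq_bigr => i _; rewrite mulrNz.
Qed.

(** Turns a linear identity into a finite comparison of coefficients that computes to [true], so
    that [abelian] can close it with [isT]. *)
Lemma zeval_eq env t u :
  all (fun i => zcoef t i == zcoef u i) (iota 0 (size env)) ->
  zeval env t = zeval env u.
Proof.
move=> /allP eq_tu; rewrite !zevalE; apply: eq_bigr => i _.
by rewrite (eqP (eq_tu i _)) // mem_iota /=.
Qed.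

End AbelianIdentities.

(** The matches on [constr:(tt)] let the tactic [unify] run inside a term-building Ltac; atoms are
    identified up to unification. *)
Ltac zindex x env :=
  lazymatch env with
  | ?y :: ?env' =>
      match constr:(tt) with
      | _ => let _ := match constr:(tt) with _ => unify x y end in constr:(0%N)
      | _ => let k := zindex x env' in constr:(S k)
      end
  end.

Ltac zinsert x env :=
  match constr:(tt) with
  | _ => let _ := zindex x env in env
  | _ => constr:(x :: env)
  end.

Ltac zatoms t env :=
  lazymatch t with
  | (?a + ?b)%R => let env := zatoms a env in zatoms b env
  | (- ?a)%R => zatoms a env
  | 0%R => env
  | _ => zinsert t env
  end.

Ltac zreify t env :=
  lazymatch t with
  | (?a + ?b)%R =>
      let a := zreify a env in let b := zreify b env in constr:(ZAdd a b)
  | (- ?a)%R => let a := zreify a env in constr:(ZOpp a)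
  | 0%R => constr:(ZZero)
  | _ => let k := zindex t env in constr:(ZVar k)
  end.

(* Decides linear identities with coefficients +1 and -1 in a zmodType. *)
Ltac abelian :=
  lazymatch goal with |- @eq ?V ?a ?b =>
    let env := zatoms a constr:(@nil V) in
    let env := zatoms b env in
    let t := zreify a env in
    let u := zreify b env in
    exact: (@zeval_eq _ env t u isT)
  end.

(** * Chevalley generators and matrix units *)

(* Locked, so that liebDl cannot see a nested bracket as a sum. *)
HB.lock Definition lieb (R : pzRingType) (x y : R) : R := x * y - y * x.

Lemma lieb_def (R : pzRingType) (x y : R) : lieb x y = x * y - y * x.
Proof. by rewrite unlock. Qed.

Section LieBracket.

Context (R : pzRingType).
Implicit Types x y z : R.

Lemma liebC x y : lieb x y = - lieb y x. Proof. by rewrite !lieb_def opprB. Qed.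
Lemma liebDl x y z : lieb (x + y) z = lieb x z + lieb y z.
Proof. by rewrite !lieb_def mulrDl mulrDr; abelian. Qed.
Lemma liebDr x y z : lieb x (y + z) = lieb x y + lieb x z.
Proof. by rewrite !lieb_def mulrDl mulrDr; abelian. Qed.
Lemma liebNl x y : lieb (- x) y = - lieb x y.
Proof. by rewrite !lieb_def mulNr mulrN; abelian. Qed.
Lemma liebNr x y : lieb x (- y) = - lieb x y.
Proof. by rewrite !lieb_def mulNr mulrN; abelian. Qed.
Lemma lieb0l x : lieb 0 x = 0. Proof. by rewrite !lieb_def mul0r mulr0 subrr. Qed.
Lemma lieb0r x : lieb x 0 = 0. Proof. by rewrite !lieb_def mul0r mulr0 subrr. Qed.
Lemma liebMnl x y n : lieb (x *+ n) y = lieb x y *+ n.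
Proof. by rewrite !lieb_def mulrnAl mulrnAr mulrnBl. Qed.
Lemma liebMnr x y n : lieb x (y *+ n) = lieb x y *+ n.
Proof. by rewrite !lieb_def mulrnAl mulrnAr mulrnBl. Qed.

Lemma jacobi x y z : lieb x (lieb y z) = lieb (lieb x y) z + lieb y (lieb x z).
Proof. by rewrite !lieb_def !(mulrBl, mulrBr) !mulrA; abelian. Qed.

End LieBracket.

Lemma lieb_converse (R : pzRingType) (x y : R) : @lieb R^c x y = lieb y x.
Proof. by rewrite !lieb_def. Qed.

Definition liebE := (liebDl, liebDr, liebNl, liebNr, lieb0l, lieb0r, liebMnl, liebMnr).

(** Indices run over all of [nat]; in the application generators out of range are 0. Only [lieb_ef]
    then needs bounds: for [k = l = n - 1] the left side would be 0, while [h k] need not vanish. *)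
Record chevalley (R : pzRingType) (n : nat) (e f h : nat -> R) : Prop := {
  torsion2 : forall x : R, x + x = 0 -> x = 0;
  lieb_hh : forall i j, lieb (h i) (h j) = 0;
  lieb_he : forall k i, lieb (h k) (e i) = e i *+ (k == i) - e i *+ (k == i.+1);
  lieb_hf : forall k i, lieb (h k) (f i) = f i *+ (k == i.+1) - f i *+ (k == i);
  lieb_ef : forall k l, (k.+1 < n)%N -> (l.+1 < n)%N ->
    lieb (e k) (f l) = (h k - h k.+1) *+ (k == l);
  serre_e : forall k, lieb (e k) (lieb (e k) (e k.+1)) = 0;
  serre_e' : forall k, lieb (e k.+1) (lieb (e k.+1) (e k)) = 0;
  comm_e : forall k l, k.+1 != l -> l.+1 != k -> lieb (e k) (e l) = 0;
  serre_f : forall k, lieb (f k) (lieb (f k) (f k.+1)) = 0;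
  serre_f' : forall k, lieb (f k.+1) (lieb (f k.+1) (f k)) = 0;
  comm_f : forall k l, k.+1 != l -> l.+1 != k -> lieb (f k) (f l) = 0
}.


(** Transposition: reversing products exchanges [e] and [f], so that results above the diagonal
    carry over below it. *)
Lemma chevalley_converse (R : pzRingType) n (e f h : nat -> R) :
  chevalley n e f h -> @chevalley R^c n f e h.
Proof.
case=> t2 hh he hf ef se se' ce sf sf' cf.
split=> [|i j|k i|k i|k l Hk Hl|k|k|k l Hk Hl|k|k|k l Hk Hl];
  rewrite ?lieb_converse ?hh //.
- by rewrite liebC hf; abelian.
- by rewrite liebC he; abelian.
- by rewrite ef // eq_sym; case: eqP => // ->.
- by rewrite liebC [lieb (f k.+1) _]liebC liebNr opprK sf.
- by rewrite liebC [lieb (f k) _]liebC liebNr opprK sf'.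
- exact: cf.
- by rewrite liebC [lieb (e k.+1) _]liebC liebNr opprK se.
- by rewrite liebC [lieb (e k) _]liebC liebNr opprK se'.
- exact: ce.
Qed.

(** * Upper triangular matrix units and their brackets with the generators *)

Section UpperUnits.

Context (R : pzRingType) (n : nat) (e f h : nat -> R).
Hypothesis eq_efh : chevalley n e f h.

(* The matrix unit in position (i, i + m + 1). *)
Fixpoint upper_unit (i m : nat) : R :=
  if m is m'.+1 then lieb (upper_unit i m') (e (i + m)) else e i.

Local Notation up := upper_unit.

(** By the Jacobi identity weights add under brackets, and those of [e i], ..., [e (i + m)]
    telescope. *)
Lemma lieb_h_upper k i m :
  lieb (h k) (up i m) = up i m *+ (k == i) - up i m *+ (k == (i + m.+1)%N).
Proof.
elim: m => [|m IH]; first by rewrite /= addn1 (lieb_he eq_efh).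
rewrite /= jacobi IH (lieb_he eq_efh) !liebE.
rewrite (_ : (i + m.+2)%N = (i + m.+1).+1) ?addnS //.
by abelian.
Qed.

(** The recursion extends the string of simple roots on the right; extending it on the left gives
    the same element, since [e k] commutes with every letter of the string but the first. *)
Lemma upper_unit_shift k m : lieb (e k) (up k.+1 m) = up k m.+1.
Proof.
elim: m => [|m IH]; first by rewrite /= addn1.
rewrite /= jacobi IH (comm_e eq_efh) ?lieb0r ?addr0 /=; try lia.
by congr (lieb _ (e _)); lia.
Qed.

(** [up i m] belongs to the string of simple roots i, ..., i + m. Adding the root k gives a new
    string only at its two ends; elsewhere the Serre and commutation relations force 0. *)
Lemma lieb_e_upper k i m :
  lieb (e k) (up i m) = up k m.+1 *+ (k.+1 == i) - up i m.+1 *+ (k == (i + m.+1)%N).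
Proof.
have [<-|neq_ki] := eqVneq k.+1 i.
  by rewrite upper_unit_shift (_ : (k == _) = false) ?subr0 //; lia.
rewrite mulr0n add0r.
have [->|neq_k] := eqVneq; first by rewrite liebC.
rewrite mulr0n oppr0.
elim: m neq_k => [|m IH] neq_k /=.
  by apply: (comm_e eq_efh) => //; lia.
have comm1 j p : (j.+1 < p)%N -> lieb (e p) (e j) = 0.
  by move=> ?; apply: (comm_e eq_efh); lia.
have e_up l j p : (j + l.+1 < p)%N -> lieb (e p) (up j l) = 0.
  elim: l => [|l IHl] lt_p /=; first by apply: comm1; lia.
  by rewrite jacobi IHl ?comm1 ?liebE ?addr0 //; lia.
(* The index [k] may be the last letter of the string, the last but one, or another one; in the
   third case the Jacobi identity and the induction hypothesis suffice. *)
have [eq_k|neq_k1] := eqVneq k (i + m.+1)%N.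
  rewrite -eq_k; case: m eq_k {IH neq_k} => [|m] eq_k /=.
    by rewrite eq_k addn1 [lieb (e i) _]liebC liebNr (serre_e' eq_efh) oppr0.
  have IHup : lieb (e k) (up i m) = 0 by apply: e_up; lia.
  have -> : lieb (lieb (up i m) (e (i + m.+1))) (e k) =
            lieb (up i m) (lieb (e (i + m.+1)) (e k)).
    by rewrite jacobi [lieb (up i m) (e k)]liebC IHup oppr0 !liebE addr0.
  rewrite jacobi IHup lieb0l add0r eq_k [lieb (e (i + m.+1)) _]liebC.
  by rewrite addnS !liebNr (serre_e' eq_efh) lieb0r oppr0.
have {IH} IH : lieb (e k) (up i m) = 0 by apply: IH.
have [eq_k|neq_k2] := eqVneq k (i + m)%N; last first.
  by rewrite jacobi IH (comm_e eq_efh) ?liebE ?addr0 //; lia.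
(* Expanding [a, [y, [a, b]]] in two ways shows that [[y, a], [a, b]] is its own
   opposite, where up i m = [y, a] and b = e (k + 1). *)
case: m eq_k neq_k1 neq_k IH => [|m] eq_k neq_k1 neq_k IH /=.
  by rewrite eq_k addn0 addn1 (serre_e eq_efh).
rewrite -eq_k; set b := e (i + _); set a := e k in IH *; set y := up i m.
have yb : lieb y b = 0 by rewrite liebC e_up ?oppr0 //; lia.
have aab : lieb a (lieb a b) = 0.
  by rewrite /a /b -(serre_e eq_efh k); congr (lieb _ (lieb _ (e _))); lia.
have aya : lieb a (lieb y a) = 0 by rewrite -IH /= -eq_k.
apply: (torsion2 eq_efh).
have -> : lieb (lieb y a) b = lieb y (lieb a b) by rewrite jacobi yb lieb0r addr0.
have E1 : lieb a (lieb y (lieb a b)) = lieb (lieb a y) (lieb a b).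
  by rewrite jacobi aab lieb0r addr0.
have E2 : lieb a (lieb y (lieb a b)) = lieb (lieb y a) (lieb a b).
  have -> : lieb y (lieb a b) = lieb (lieb y a) b by rewrite jacobi yb lieb0r addr0.
  by rewrite jacobi aya lieb0l add0r.
by rewrite {1}E1 E2 [lieb y a]liebC liebNl; abelian.
Qed.

Lemma lieb_f_upper0 k i : (k.+1 < n)%N -> (i.+1 < n)%N ->
  lieb (f k) (up i 0) = (h i.+1 - h i) *+ (k == i).
Proof.
move=> ltk lti; rewrite /= liebC (lieb_ef eq_efh) // eq_sym.
by rewrite -mulNrn opprB.
Qed.

(** Bracketing with [f k] removes the simple root k, which leaves a connected string only if k is
    its first or last element. *)
Lemma lieb_f_upperS k i m : (k.+1 < n)%N -> (i + m.+2 < n)%N ->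
  lieb (f k) (up i m.+1) = up i.+1 m *+ (k == i) - up i m *+ (k == (i + m.+1)%N).
Proof.
move=> ltk; elim: m => [|m IH] lti; rewrite [up i _]/= jacobi.
  rewrite (lieb_f_upper0 ltk) ?[lieb (f k) (e _)](@lieb_f_upper0 k) //=; try lia.
  rewrite !addn1 !liebE !(lieb_he eq_efh) [lieb _ (h i.+2)]liebC [lieb _ (h i.+1)]liebC.
  have [-> ->] : (i.+1 == i.+2) = false /\ (i == i.+1) = false by split; lia.
  rewrite !(lieb_he eq_efh) !eqxx.
  have [-> ->] : (i.+1 == i) = false /\ (i.+2 == i) = false by split; lia.
  have [-> ->] : (i.+2 == i.+1) = false /\ (i == i.+2) = false by split; lia.
  by case: (k == i); case: (k == i.+1); rewrite !(mulr0n, mulr1n); abelian.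
rewrite IH ?[lieb (f k) (e _)](@lieb_f_upper0 k) //; try lia.
rewrite !liebE [lieb (up i m) (e _)]liebC lieb_e_upper.
have [-> ->] : ((i + m.+2).+1 == i) = false /\ ((i + m.+2)%N == (i + m.+1)%N) = false by split; lia.
rewrite -/(up i m.+1) [lieb _ (h (i + m.+2).+1)]liebC [lieb _ (h (i + m.+2))]liebC !lieb_h_upper.
rewrite !eqxx.
have [-> ->] : ((i + m.+2).+1 == i) = false /\ ((i + m.+2)%N == i) = false by split; lia.
have -> : ((i + m.+2).+1 == (i + m.+2)%N) = false by lia.
have <- : lieb (up i.+1 m) (e (i + m.+2)) = up i.+1 m.+1 by rewrite -addSnnS.
by case: (k == i); case: (k == (i + m.+1)%N); case: (k == (i + m.+2)%N);
  rewrite !(mulr0n, mulr1n); abelian.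
Qed.

End UpperUnits.

(** * All matrix units and the commutation relations of gl_n *)

Section MatrixUnits.

Context (R : pzRingType).

(** Below the diagonal the same recursion runs on [f] in the opposite ring, so that transposition is
    built into the definition. *)
Definition matrix_unit (e f h : nat -> R) (i j : nat) : R :=
  if (i < j)%N then upper_unit e i (j - i).-1
  else if (j < i)%N then @upper_unit R^c f j (i - j).-1 else h i.

Context (e f h : nat -> R).

Local Notation E := (matrix_unit e f h).

Lemma matrix_unit_upper i m : E i (i + m.+1) = upper_unit e i m.
Proof. by rewrite /matrix_unit addKn ifT //; lia. Qed.

Lemma matrix_unit_lower j m : E (j + m.+1) j = @upper_unit R^c f j m.
Proof. by rewrite /matrix_unit addKn ifF ?ifT //; lia. Qed.

Lemma matrix_unit_e k : E k k.+1 = e k.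
Proof. by rewrite -addn1 matrix_unit_upper. Qed.

Lemma matrix_unit_f k : E k.+1 k = f k.
Proof. by rewrite -addn1 matrix_unit_lower. Qed.

Lemma matrix_unit_diag i : E i i = h i.
Proof. by rewrite /matrix_unit ltnn. Qed.

End MatrixUnits.

Lemma matrix_unit_converse (R : pzRingType) (e f h : nat -> R) i j :
  @matrix_unit R^c f e h j i = matrix_unit e f h i j.
Proof.
have convK k m : @upper_unit (R^c)^c e k m = upper_unit e k m.
  by elim: m => //= m ->; rewrite !lieb_converse.
by rewrite /matrix_unit convK; have [lt_ij|lt_ji|->] := ltngtP i j.
Qed.

Section Adjoint.

Context (R : pzRingType) (n : nat) (e f h : nat -> R).
Hypothesis eq_efh : chevalley n e f h.

Local Notation E := (matrix_unit e f h).

(** Says that [x] has the brackets expected of [E a b]. The property passes to brackets, so it has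
    to be checked by hand on generators only. *)
Definition acts_as_unit (x : R) (a b : nat) := forall k l, (k < n)%N -> (l < n)%N ->
  lieb x (E k l) = E a l *+ (b == k) - E k b *+ (l == a).

Lemma order_split i j : [\/ exists m, j = (i + m.+1)%N, i = j | exists m, i = (j + m.+1)%N].
Proof.
have [lt_ij|lt_ji|->] := ltngtP i j; last by constructor.
- by constructor 1; exists (j - i).-1; lia.
- by constructor 3; exists (i - j).-1; lia.
Qed.

(** Below the diagonal the claim is transposed: there [e k] plays the part of an [f] acting on an
    upper unit. *)
Lemma acts_e k : (k.+1 < n)%N -> acts_as_unit (e k) k k.+1.
Proof.
move=> ltk i j lti ltj; case: (order_split i j) => [[m ->]|eq_ij|[m eq_i]].
- rewrite matrix_unit_upper (lieb_e_upper eq_efh); congr (_ - _).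
    by case: eqP => // <-; rewrite addSnnS matrix_unit_upper.
  by rewrite eq_sym; case: eqP => // <-; rewrite -addnS matrix_unit_upper.
- rewrite eq_ij matrix_unit_diag liebC (lieb_he eq_efh) opprB; congr (_ - _).
    by rewrite eq_sym; case: eqP => // <-; rewrite matrix_unit_e.
  by rewrite eq_sym; case: eqP => // ->; rewrite matrix_unit_e.
- rewrite {}eq_i in lti *; rewrite matrix_unit_lower liebC -lieb_converse.
  have eqc := chevalley_converse eq_efh.
  case: m lti => [|m] lti.
    rewrite (lieb_f_upper0 eqc) //; last by lia.
    rewrite !addn1 eqSS [j == k]eq_sym; case: eqP => [->|_]; rewrite ?mulr0n ?subr0 ?oppr0 //.
    by rewrite !mulr1n !matrix_unit_diag opprB.
  rewrite (lieb_f_upperS eqc) //.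
  rewrite opprB; congr (_ - _).
    have [->|neq_k] := eqVneq k (j + m.+1)%N; first by rewrite -addnS eqxx matrix_unit_lower.
    by case: eqP => //; lia.
  by rewrite [k == j]eq_sym; case: eqP => // ->; rewrite -addSnnS matrix_unit_lower.
Qed.

Lemma acts_h k : acts_as_unit (h k) k k.
Proof.
move=> i j lti ltj; case: (order_split i j) => [[m ->]|->|[m ->]].
- rewrite matrix_unit_upper (lieb_h_upper eq_efh) [_ == k]eq_sym.
  congr (_ - _); first by case: eqP => // ->; rewrite matrix_unit_upper.
  by case: eqP => // ->; rewrite matrix_unit_upper.
- rewrite matrix_unit_diag (lieb_hh eq_efh) [j == k]eq_sym.
  by case: eqP => [->|_]; rewrite ?matrix_unit_diag subrr.
- rewrite matrix_unit_lower liebC -lieb_converse.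
  rewrite (lieb_h_upper (chevalley_converse eq_efh)) opprB [_ == k]eq_sym.
  congr (_ - _); first by case: eqP => // ->; rewrite matrix_unit_lower.
  by case: eqP => // ->; rewrite matrix_unit_lower.
Qed.

(** The Jacobi identity expresses the adjoint action of [lieb x y] by those of [x] and [y]; [a != c]
    excludes the extra term [E b b]. *)
Lemma acts_lieb x y a b c : (a < n)%N -> (b < n)%N -> (c < n)%N -> a != c ->
  acts_as_unit x a b -> acts_as_unit y b c -> acts_as_unit (lieb x y) a c.
Proof.
move=> lta ltb ltc neq_ac x_ab y_bc k l ltk ltl.
have -> : lieb (lieb x y) (E k l) = lieb x (lieb y (E k l)) - lieb y (lieb x (E k l)).
  by rewrite jacobi; abelian.
rewrite x_ab // y_bc // !liebE !x_ab // !y_bc // !eqxx [c == a]eq_sym (negPf neq_ac).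
rewrite !mulr1n !mulr0n !subr0 ?sub0r ?mulrnBl.
by case: (eqVneq l b) => [?|_]; case: (eqVneq c k) => [?|_];
   case: (eqVneq l a) => [?|_]; case: (eqVneq b k) => [?|_];
   subst; rewrite ?(mulr0n, mulr1n); abelian.
Qed.

End Adjoint.

Section MatrixUnitRelations.

Context (R : pzRingType) (n : nat) (e f h : nat -> R).
Hypothesis eq_efh : chevalley n e f h.

Local Notation E := (matrix_unit e f h).
Local Notation acts := (acts_as_unit n e f h).

Lemma acts_f k : (k.+1 < n)%N -> acts (f k) k.+1 k.
Proof.
move=> ltk i j lti ltj.
have := acts_e (chevalley_converse eq_efh) ltk ltj lti.
rewrite lieb_converse !matrix_unit_converse => Eq.
by rewrite liebC Eq opprB eq_sym [_ == j]eq_sym.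
Qed.

Lemma acts_upper i m : (i + m.+1 < n)%N -> acts (upper_unit e i m) i (i + m.+1).
Proof.
elim: m => [|m IH] ltn; first by rewrite addn1; apply: (acts_e eq_efh); lia.
rewrite [(i + m.+2)%N]addnS; apply: (acts_lieb (b := (i + m.+1)%N)); try lia.
- by apply: IH; lia.
- by apply: (acts_e eq_efh); lia.
Qed.

Lemma acts_lower j m : (j + m.+1 < n)%N -> acts (@upper_unit R^c f j m) (j + m.+1) j.
Proof.
elim: m => [|m IH] ltn; first by rewrite addn1; apply: acts_f; lia.
rewrite /= lieb_converse [(j + m.+2)%N]addnS; apply: (acts_lieb (b := (j + m.+1)%N)); try lia.
- by apply: acts_f; lia.
- by apply: IH; lia.
Qed.

(** Only the first unit is decomposed: off the diagonal it is an iterated bracket of generators,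
    whose adjoint action is built up one bracket at a time. *)
Lemma lieb_matrix_unit i j k l :
  (i < n)%N -> (j < n)%N -> (k < n)%N -> (l < n)%N ->
  lieb (E i j) (E k l) = E i l *+ (j == k) - E k j *+ (l == i).
Proof.
move=> lti ltj ltk ltl; move: k l ltk ltl; rewrite -/(acts (E i j) i j).
case: (order_split i j) => [[m eq_j]|->|[m eq_i]].
- by rewrite eq_j matrix_unit_upper; apply: acts_upper; lia.
- by rewrite matrix_unit_diag; apply: (acts_h eq_efh).
- by rewrite eq_i matrix_unit_lower; apply: acts_lower; lia.
Qed.

End MatrixUnitRelations.


(** * Normally ordered products *)

(** Adjacent transpositions suffice: they carry the head of [s] to the front of [t], and induction
    treats the tails. *)
Lemma swap_perm (T : eqType) (V : Type) (F : seq T -> V) :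
  (forall u x y v, F (u ++ x :: y :: v) = F (u ++ y :: x :: v)) ->
  forall s t, perm_eq s t -> F s = F t.
Proof.
move=> swapF s; elim: s F swapF => [|x s IH] F swapF t.
  by rewrite perm_sym => /perm_nilP ->.
move=> eq_st; have x_t : x \in t by rewrite -(perm_mem eq_st) mem_head.
case/splitPr: x_t eq_st => t1 t2 eq_st.
have -> : F (t1 ++ x :: t2) = F (x :: t1 ++ t2).
  elim/last_ind: t1 t2 {eq_st} => // t1 y IHt t2.
  by rewrite cat_rcons swapF IHt cat_rcons.
apply: (IH (fun v => F (x :: v))) => [u y z v|]; first exact: (swapF (x :: u)).
rewrite -(perm_cons x); apply: perm_trans eq_st _.
exact: (permEl (perm_catCA t1 [:: x] t2)).
Qed.

(** * Sums over the replacements of one letter of a word *)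

Section LetterSubstitution.

Context (T : eqType) (V : zmodType).
Implicit Types (b : pred T) (g : T -> T) (F : seq T -> V) (w : seq T).

(* Sum of F over the words obtained from w by replacing one letter x satisfying
   b by g x. *)
Fixpoint wsub b g F w : V :=
  if w is x :: w' then F (g x :: w') *+ b x + wsub b g (fun v => F (x :: v)) w'
  else 0.

Lemma eq_wsub b g F G w :
  (forall v, size v = size w -> F v = G v) -> wsub b g F w = wsub b g G w.
Proof.
elim: w F G => //= x w IH F G eqFG; rewrite eqFG //; congr (_ + _).
by apply: IH => v eq_v; apply: eqFG; rewrite /= eq_v.
Qed.


End LetterSubstitution.

Section SubstitutionMorphism.

Context (T : eqType) (V W : zmodType) (phi : V -> W).
Hypotheses (phi0 : phi 0 = 0) (phiD : {morph phi : x y / x + y}).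

Lemma wsub_morph (b : pred T) g F w :
  wsub b g (fun v => phi (F v)) w = phi (wsub b g F w).
Proof.
elim: w F => //= x w IH F; rewrite IH phiD; congr (_ + _).
by case: (b x).
Qed.

End SubstitutionMorphism.

Section SubstitutionTheory.

Context (T : eqType) (V : zmodType).
Implicit Types (b : pred T) (g : T -> T) (F : seq T -> V) (w : seq T).

Lemma wsubD b g F G w :
  wsub b g (fun v => F v + G v) w = wsub b g F w + wsub b g G w.
Proof.
by elim: w F G => [|x w IH] F G /=; rewrite ?addr0 // IH mulrnDl; abelian.
Qed.

Lemma wsubN b g F w : wsub b g (fun v => - F v) w = - wsub b g F w.
Proof. by apply: (wsub_morph (oppr0 V) (@opprD V)). Qed.

Lemma wsubMn b g F w k : wsub b g (fun v => F v *+ k) w = wsub b g F w *+ k.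
Proof.
by apply: (@wsub_morph _ _ _ (fun x => x *+ k)); rewrite ?mul0rn // => x y; rewrite mulrnDl.
Qed.

Lemma wsub0 b g F w :
  (forall v, size v = size w -> F v = 0) -> wsub b g F w = 0.
Proof.
elim: w F => //= x w IH F F0; rewrite F0 // mul0rn add0r.
by apply: IH => v eq_v; apply: F0; rewrite /= eq_v.
Qed.

(** The summands sort the two replacements by whether both, exactly one or none of them hits the
    head. *)
Lemma wsub_cons2 b1 g1 b2 g2 F x w :
  wsub b1 g1 (wsub b2 g2 F) (x :: w) =
    F (g2 (g1 x) :: w) *+ b2 (g1 x) *+ b1 x
    + (wsub b2 g2 (fun v => F (g1 x :: v)) w *+ b1 x
       + wsub b1 g1 (fun v => F (g2 x :: v)) w *+ b2 x)
    + wsub b1 g1 (wsub b2 g2 (fun v => F (x :: v))) w.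
Proof. by rewrite /= wsubD wsubMn mulrnDl; abelian. Qed.

Lemma wsub_swap b g F :
  (forall u x y v, F (u ++ x :: y :: v) = F (u ++ y :: x :: v)) ->
  forall u x y v, wsub b g F (u ++ x :: y :: v) = wsub b g F (u ++ y :: x :: v).
Proof.
move=> swapF u; elim: u F swapF => [|z u IH] F swapF x y v /=.
  rewrite !(swapF nil _ (g _)) (swapF nil (g x)).
  rewrite (_ : wsub _ _ _ v = wsub b g (fun s => F (y :: x :: s)) v); first by abelian.
  by apply: eq_wsub => s _; apply: (swapF nil).
rewrite -cat_cons swapF cat_cons; congr (_ + _).
by apply: IH => u' x' y' v'; apply: (swapF (z :: u')).
Qed.

(** Evaluates a replacement sum in which each admissible letter contributes [z] or nothing, as [a]
    decides. *)
Lemma wsub_count b g F w z (a : pred T) :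
  (forall u x v, w = u ++ x :: v -> b x -> F (u ++ g x :: v) = z *+ a x) ->
  wsub b g F w = z *+ count (predI b a) w.
Proof.
elim: w F => //= x w IH F Fz.
rewrite (IH (fun v => F (x :: v))) => [|u y v eq_w b_y]; last first.
  by apply: (Fz (x :: u)); rewrite ?eq_w.
rewrite mulrnDr; congr (_ + _); case: (boolP (b x)) => //= bx.
by rewrite mulr1n (Fz nil).
Qed.

End SubstitutionTheory.

(** * Symmetry and adjoint action of normally ordered products *)

Section NormalOrder.

Context (I : eqType).
Local Notation word := (seq (I * I)).

Section LeftRight.

Context (V : zmodType).
Implicit Types (F : word -> V) (w : word).

(* The letter (k, l) stands for the matrix unit E k l; lsub i j and rsub i j
   multiply one letter by E i j on the left and on the right. *)
Definition lsub i j F w :=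
  wsub (fun x => j == x.1) (fun x => (i, x.2)) F w.
Definition rsub i j F w :=
  wsub (fun x => x.2 == i) (fun x => (x.1, j)) F w.

(** Replacements at different letters commute, so only those at the same letter remain. The outer
    substitution changes the word first, hence the sign opposite to the one for matrix units. *)
Lemma lsub_comm i j k l F w :
  lsub i j (lsub k l F) w - lsub k l (lsub i j F) w =
  lsub k j F w *+ (l == i) - lsub i l F w *+ (j == k).
Proof.
rewrite /lsub; elim: w F => [|[p q] w IH] F; first by rewrite /= !mul0rn subrr.
rewrite !wsub_cons2 /= !mulrnDl.
have /(canRL (subrK _)) -> := IH (fun v => F ((p, q) :: v)).
by case: (l == i); case: (j == p); case: (j == k); case: (l == p);
  rewrite !(mulr0n, mulr1n); abelian.
Qed.

Lemma lsub_rsub i j k l F w :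
  lsub i j (rsub k l F) w = rsub k l (lsub i j F) w.
Proof.
rewrite /lsub /rsub; elim: w F => [|[p q] w IH] F //.
rewrite !wsub_cons2 /= IH; congr (_ + _).
by case: (j == p); case: (q == k); rewrite !(mulr0n, mulr1n); abelian.
Qed.

End LeftRight.

Context (R : pzRingType) (E : I -> I -> R).
Hypothesis lieb_E : forall i j k l,
  lieb (E i j) (E k l) = E i l *+ (j == k) - E k j *+ (l == i).

(* The normally ordered product of a word of length m: in gl_act, the sum over
   all ways to put the letters of the word in m distinct tensor places.  It is
   0 on words of another length. *)
Fixpoint normal (m : nat) (w : word) : R :=
  match m, w with
  | 0, [::] => 1
  | m'.+1, x :: w' => E x.1 x.2 * normal m' w' - lsub x.1 x.2 (normal m') w'
  | _, _ => 0
  end.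

Lemma normal_size m w : size w != m -> normal m w = 0.
Proof.
elim: m w => [|m IH] [|x w] //= size_w.
rewrite IH // mulr0 sub0r /lsub wsub0 ?oppr0 // => v eq_v.
by rewrite IH // eq_v.
Qed.

Lemma lsub_normal_cons i j m x w :
  lsub i j (fun v => normal m.+1 (x :: v)) w =
  E x.1 x.2 * lsub i j (normal m) w - lsub i j (lsub x.1 x.2 (normal m)) w.
Proof.
rewrite /lsub /= wsubD wsubN; congr (_ - _).
by apply: (@wsub_morph _ _ _ ( *%R (E x.1 x.2))); [rewrite mulr0|move=> ? ?; rewrite mulrDr].
Qed.

(** For the two head letters, the expansion leaves the commutator of their matrix units and that of
    their substitutions. Together these cancel against the terms in which one head letter is
    multiplied into the other. *)
Lemma normal_swap m u x y v :
  normal m (u ++ x :: y :: v) = normal m (u ++ y :: x :: v).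
Proof.
elim: m u x y v => [|m IH] [|z u] x y v //; last first.
  by rewrite /= IH /lsub (wsub_swap _ _ IH).
case: m IH => [|m] _; first by rewrite !normal_size.
rewrite !cat0s [LHS]/= [RHS]/=.
have step p q : lsub p.1 p.2 (normal m.+1) (q :: v) =
  normal m.+1 ((p.1, q.2) :: v) *+ (p.2 == q.1)
  + lsub p.1 p.2 (fun s => normal m.+1 (q :: s)) v by [].
rewrite !step !lsub_normal_cons /= !mulrBr !mulrA.
have := lsub_comm x.1 x.2 y.1 y.2 (normal m) v.
move: (lieb_E x.1 x.2 y.1 y.2); rewrite lieb_def => /(canRL (subrK _)) ->.
move/(canRL (subrK _)) ->.
rewrite !mulrDl !mulNr !mulrnAl !mulrnBl.
by abelian.
Qed.

Lemma normal_perm m w w' : perm_eq w w' -> normal m w = normal m w'.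
Proof. exact/swap_perm/normal_swap. Qed.

Lemma lieb_mulr (x y z : R) : lieb x (y * z) = lieb x y * z + y * lieb x z.
Proof. by rewrite !lieb_def mulrBl mulrBr !mulrA; abelian. Qed.

(** Bracketing with [E i j] is a derivation, and on a single letter it is left minus right
    multiplication by [E i j]. *)
Lemma lieb_normal i j m w :
  lieb (E i j) (normal m w) = lsub i j (normal m) w - rsub i j (normal m) w.
Proof.
elim: m w => [|m IH] [|x w].
- by rewrite /= lieb_def mul1r mulr1 !subrr.
- by rewrite normal_size // lieb0r /lsub /rsub !wsub0 ?subrr // => v eq_v;
    rewrite normal_size ?eq_v.
- by rewrite /= lieb0r subrr.
rewrite [normal _ _]/= liebDr liebNr lieb_mulr lieb_E IH.
have -> : lieb (E i j) (lsub x.1 x.2 (normal m) w) =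
          lsub x.1 x.2 (lsub i j (normal m)) w - lsub x.1 x.2 (rsub i j (normal m)) w.
  rewrite /lsub -(@wsub_morph _ _ _ (lieb (E i j))) ?lieb0r //; last exact: liebDr.
  by rewrite -wsubN -wsubD; apply: eq_wsub => v _; rewrite IH.
have stepl : lsub i j (normal m.+1) (x :: w) =
  normal m.+1 ((i, x.2) :: w) *+ (j == x.1)
  + lsub i j (fun s => normal m.+1 (x :: s)) w by [].
have stepr : rsub i j (normal m.+1) (x :: w) =
  normal m.+1 ((x.1, j) :: w) *+ (x.2 == i)
  + rsub i j (fun s => normal m.+1 (x :: s)) w by [].
have rsub_cons : rsub i j (fun s => normal m.+1 (x :: s)) w =
  E x.1 x.2 * rsub i j (normal m) w - rsub i j (lsub x.1 x.2 (normal m)) w.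
  rewrite /rsub /= wsubD wsubN; congr (_ - _).
  by apply: (@wsub_morph _ _ _ ( *%R (E x.1 x.2))); [rewrite mulr0|move=> ? ?; rewrite mulrDr].
rewrite stepl stepr lsub_normal_cons rsub_cons -lsub_rsub /=.
have /(canRL (subrK _)) -> := lsub_comm i j x.1 x.2 (normal m) w.
rewrite !mulrBl !mulrBr !mulrnAl.
by case: (j == x.1); case: (x.2 == i); rewrite !(mulr0n, mulr1n); abelian.
Qed.

End NormalOrder.


(** * Vanishing of normally ordered products, reduced to diagonal words *)

Section Vanishing.

Context (I : eqType) (R : pzRingType) (E : I -> I -> R) (m : nat).
Hypothesis lieb_E : forall i j k l,
  lieb (E i j) (E k l) = E i l *+ (j == k) - E k j *+ (l == i).
Hypothesis torsion_free : forall (x : R) k, x *+ k.+1 = 0 -> x = 0.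

Local Notation off := (fun x : I * I => x.1 != x.2).

(* The bracket of E i j with normal E m ((j, j) :: v) is a positive multiple of
   normal E m ((i, j) :: v), up to words with fewer off-diagonal letters and up to
   a word with one letter (i, i) of v turned into (j, j). *)
Lemma normal_vanish :
  (forall s : seq I, normal E m [seq (k, k) | k <- s] = 0) ->
  forall w, normal E m w = 0.
Proof.
move=> diag0 w; have [k] := ubnP (count off w).
elim: k w => // k IHk w; rewrite ltnS => le_w.
have [/hasP[[i j] ij_w /= neq_ij]|/hasPn off_w] := boolP (has off w); last first.
  rewrite (_ : w = [seq (k, k) | k <- map fst w]) //.
  rewrite -map_comp -[LHS]map_id; apply/eq_in_map => -[p q] /off_w /=.
  by rewrite negbK => /eqP ->.
have {}IHk v : (count off v < count off w)%N -> normal E m v = 0.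
  by move=> lt_v; apply: IHk; apply: leq_trans le_w.
have perm_w := perm_to_rem ij_w; rewrite (normal_perm lieb_E m perm_w).
have : (count off (rem (i, j) w) < count off w)%N.
  by rewrite (seq.permP perm_w off) /= neq_ij.
(* Inner induction on the number of letters [(i, i)]; the outer one is on the number of off-diagonal
   letters. *)
move: (rem _ _) => v {perm_w ij_w}; have [b] := ubnP (count_mem (i, i) v).
elim: b v => // b IHb v; rewrite ltnS => le_v lt_v.
have off_v u : count off u = count off v -> normal E m u = 0.
  by move=> eq_u; apply: IHk; rewrite eq_u.
have := lieb_normal lieb_E i j m ((j, j) :: v).
rewrite (off_v ((j, j) :: v)) /= ?eqxx // lieb0r.
set z := normal E m ((i, j) :: v).
rewrite {1}/lsub (@wsub_count _ _ _ _ _ _ z (pred1 (j, j))); last first.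
  move=> u [p q] u' eq_v /= /eqP eq_p; rewrite -{p}eq_p in eq_v *.
  have [[eq_q]|neq_q] := eqVneq (j, q) (j, j).
    rewrite eq_q in eq_v *; rewrite mulr1n; apply: (normal_perm lieb_E).
    rewrite -[u ++ _]/(u ++ [:: (i, j)] ++ u') perm_catCA perm_cons.
    rewrite -(perm_cons (j, j)) eq_v.
    by rewrite -[u ++ (j, j) :: _]/(u ++ [:: (j, j)] ++ u') perm_sym perm_catCA.
  (* Turning [(j, q)] with [q != j] into [(i, q)] cannot raise the number of off-diagonal letters,
     which is already below that of [w]. *)
  rewrite mulr0n; apply: IHk; apply: leq_ltn_trans lt_v.
  have -> : count off v = count off ((j, j) :: v) by rewrite /= eqxx.
  rewrite eq_v !count_cat /= leq_add2l leq_add2r.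
  by move: neq_q; rewrite xpair_eqE eqxx /= eq_sym => ->; case: (_ != _).
set y := normal E m ((i, j) :: rem (i, i) ((j, j) :: v)).
rewrite {1}/rsub (@wsub_count _ _ _ _ _ _ y (pred1 (i, i))); last first.
  move=> u [p q] u' eq_v /= /eqP eq_q; rewrite {q}eq_q in eq_v *.
  have [[eq_p]|neq_p] := eqVneq (p, i) (i, i).
    rewrite eq_p in eq_v *; rewrite mulr1n; apply: (normal_perm lieb_E).
    rewrite -[u ++ _]/(u ++ [:: (i, j)] ++ u') perm_catCA perm_cons.
    rewrite -(perm_cons (i, i)) -[_ :: u ++ u']/([:: (i, i)] ++ u ++ u') perm_catCA.
    by rewrite -[u ++ _]/(u ++ (i, i) :: u') -eq_v perm_to_rem // eq_v mem_cat mem_head orbT.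
  rewrite mulr0n; apply: IHk; apply: leq_ltn_trans lt_v.
  have -> : count off v = count off ((j, j) :: v) by rewrite /= eqxx.
  rewrite eq_v !count_cat /= leq_add2l leq_add2r.
  by move: neq_p; rewrite xpair_eqE eqxx andbT => ->; case: (_ != _).
(* Turning [(i, i)] into [(i, j)] uses up one letter [(i, i)], so the inner induction hypothesis
   kills [y]. *)
have -> : y *+ count (predI (fun x => x.2 == i) (pred1 (i, i))) ((j, j) :: v) = 0.
  have [ii_v|nii_v] := boolP ((i, i) \in (j, j) :: v); last first.
    rewrite (eq_in_count (a2 := pred0)) ?count_pred0 // => x x_v /=.
    by apply: contraNF nii_v => /andP[_ /eqP <-].
  have ii_v' : (i, i) \in v.
    by move: ii_v; rewrite inE xpair_eqE (negPf neq_ij).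
  rewrite /y IHb ?mul0rn //.
    rewrite /= [_ == (i, i)]xpair_eqE eq_sym (negPf neq_ij) /=.
    rewrite xpair_eqE eq_sym (negPf neq_ij) /= add0n.
    by apply: leq_trans le_v; rewrite (seq.permP (perm_to_rem ii_v')) /= eqxx.
  rewrite /= [_ == (i, i)]xpair_eqE eq_sym (negPf neq_ij) /= eqxx add0n.
  by rewrite (seq.permP (perm_to_rem ii_v')) /= eqxx in lt_v.
(* The letter [(j, j)] in front makes the multiplicity of [z] a successor. *)
rewrite subr0 /= eqxx /= eqxx add1n => /esym; exact: torsion_free.
Qed.

End Vanishing.

Section DiagonalSum.

Context (I : finType).

Lemma sum_lsub (V : zmodType) (F : seq (I * I) -> V) w :
  \sum_i lsub i i F w = F w *+ size w.
Proof.
rewrite /lsub; elim: w F => [|[p q] w IH] F /=; first by rewrite big1.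
rewrite big_split /= IH mulrS; congr (_ + _).
rewrite (bigD1 p) //= eqxx mulr1n big1 ?addr0 // => i neq_ip.
by rewrite (negPf neq_ip).
Qed.

(** Where the [E i i] sum to [d], the right side is [normal E m w] times the integer [d - size w];
    this is what lengthens words. *)
Lemma sum_normal (R : pzRingType) (E : I -> I -> R) m w :
  \sum_i normal E m.+1 ((i, i) :: w) =
  (\sum_i E i i) * normal E m w - normal E m w *+ size w.
Proof. by rewrite sumrB mulr_suml sum_lsub. Qed.

End DiagonalSum.

Lemma normal_morph (I : eqType) (R S : pzRingType) (phi : R -> S)
    (E : I -> I -> R) m w :
  zmod_morphism phi -> monoid_morphism phi ->
  phi (normal E m w) = normal (fun i j => phi (E i j)) m w.
Proof.
move=> phiB [phi1 phiM].
have phi0 : phi 0 = 0 by rewrite -(subrr 0) phiB subrr.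
have phiN x : phi (- x) = - phi x by rewrite -sub0r phiB phi0 sub0r.
have phiD : {morph phi : x y / x + y} by move=> x y; rewrite -[y]opprK phiB !phiN.
elim: m w => [|m IH] [|x w] //=; rewrite phiB phiM IH; congr (_ - _).
by rewrite /lsub -(wsub_morph phi0 phiD); apply: eq_wsub => v _; rewrite IH.
Qed.


(** * The relations in the Schur algebra *)

Section TensorAction.

Context (n d : nat).
Local Notation multi := {ffun 'I_d -> 'I_n}.
Local Notation T := (tensor_end n d).

Lemma tensor_endM (x y : T) t : (x * y) t = x (y t).
Proof. exact: comp_lfunE. Qed.

Lemma tensor_end1 t : (1 : T) t = t.
Proof. exact: id_lfunE. Qed.

Lemma tensor_endP (x y : T) : (forall t w, x t w = y t w) -> x = y.
Proof. by move=> eq_xy; apply/lfunP => t; apply/ffunP => w. Qed.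

Definition upd (w : multi) (r : 'I_d) (j : 'I_n) : multi :=
  [ffun s => if s == r then j else w s].

(** The matrix unit in position (i, j) acting at place [r]. Coordinates are pulled back: the row [i]
    is tested on [w] and the column [j] enters the argument of [t]. *)
Definition place_fun (r : 'I_d) (i j : 'I_n) (t : tensor n d) : tensor n d :=
  [ffun w : multi => t (upd w r j) *+ (w r == i)].

Fact place_fun_is_linear r i j : linear (place_fun r i j).
Proof. by move=> k t u; apply/ffunP=> w; rewrite !ffunE mulrnDl -mulrnAr. Qed.
HB.instance Definition _ r i j := GRing.isLinear.Build rat (tensor n d)
  (tensor n d) *:%R (place_fun r i j) (place_fun_is_linear r i j).

Definition place (r : 'I_d) (i j : 'I_n) : T := linfun (place_fun r i j).

Lemma placeE r i j t w : place r i j t w = t (upd w r j) *+ (w r == i).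
Proof. by rewrite lfunE /= ffunE. Qed.

Definition unit_act (i j : 'I_n) : T := \sum_r place r i j.

Lemma unit_actE i j t w :
  unit_act i j t w = \sum_r t (upd w r j) *+ (w r == i).
Proof.
rewrite /unit_act sum_lfunE sum_ffunE; apply: eq_bigr => r _; exact: placeE.
Qed.

Lemma gl_act_delta i j : gl_act d (delta_mx i j) = unit_act i j.
Proof.
apply: eq_bigr => r _; apply: tensor_endP => t w.
rewrite placeE lfunE /= ffunE (bigD1 (upd w r j)) //= [X in _ + X]big1 ?addr0.
  rewrite (bigD1 r) //= eqxx mxE ffunE !eqxx andbT big1 ?mulr1.
    by rewrite mulr_natl.
  by move=> s neq_sr; rewrite (negPf neq_sr) mxE ffunE (negPf neq_sr) eqxx.
(* Any other word differs from [upd w r j] at some place [s], where the matrix entry is 0. *)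
move=> u neq_u; rewrite (_ : \prod_(_ < _) _ = 0) ?mul0r //.
have [s neq_s] : exists s, u s != upd w r j s.
  by apply/existsP; apply: contraR neq_u => /existsPn eq_u; apply/eqP/ffunP => s;
     apply/eqP; rewrite -[_ == _]negbK.
rewrite (bigD1 s) //= ffunE in neq_s *.
move: neq_s; have [_|_] := eqVneq s r => neq_s; rewrite mxE.
  by rewrite (negPf neq_s) andbF mul0r.
by rewrite eq_sym (negPf neq_s) mul0r.
Qed.

Lemma placeM r i j k l : place r i j * place r k l = place r i l *+ (j == k).
Proof.
apply: tensor_endP => t w; rewrite tensor_endM placeE placeE ffunE eqxx.
have -> : upd (upd w r j) r l = upd w r l by apply/ffunP => s; rewrite !ffunE; case: eqP.
by case: (j == k); rewrite ?mulr1n ?mulr0n ?mul0rn ?placeE // zero_lfunE ffunE.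
Qed.

Lemma place_comm r s i j k l : r != s ->
  place r i j * place s k l = place s k l * place r i j.
Proof.
move=> neq_rs; have neq_sr : s != r by rewrite eq_sym.
apply: tensor_endP => t w; rewrite !tensor_endM !placeE !ffunE.
rewrite (negPf neq_sr) (negPf neq_rs).
have -> : upd (upd w r j) s l = upd (upd w s l) r j.
  by apply/ffunP => p; rewrite !ffunE; case: eqP => // ->; rewrite (negPf neq_sr).
by rewrite -!mulrnA mulnC.
Qed.

(** Operators at different places commute, so only the diagonal of the double sum over places
    remains. *)
Lemma lieb_unit_act i j k l : lieb (unit_act i j) (unit_act k l) =
  unit_act i l *+ (j == k) - unit_act k j *+ (l == i).
Proof.
rewrite lieb_def /unit_act !mulr_suml.
under eq_bigr do rewrite mulr_sumr.
under [X in _ - X]eq_bigr do rewrite mulr_sumr.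
rewrite [X in _ - X]exchange_big -sumrB -!sumrMnl -sumrB; apply: eq_bigr => r _ /=.
rewrite -sumrB (bigD1 r) //= !placeM big1 ?addr0 // => s neq_sr.
by rewrite place_comm ?subrr // eq_sym.
Qed.

Definition content (w : multi) (k : 'I_n) : nat := #|[pred r | w r == k]|.

Lemma sum_content w : \sum_k content w k = d.
Proof.
rewrite -[RHS]card_ord -sum1_card (partition_big w xpredT) //=.
by apply: eq_bigr => k _; rewrite /content -sum1_card; apply: eq_bigl => r; rewrite inE.
Qed.

Lemma content_le w k : (content w k < d.+1)%N.
Proof. by rewrite ltnS -[X in (_ <= X)%N]card_ord max_card. Qed.

Fact word_weight_subproof w :
  (\sum_k [ffun k => Ordinal (content_le w k)] k == d)%N.
Proof. by apply/eqP; rewrite -[RHS](sum_content w); apply: eq_bigr => k _; rewrite ffunE. Qed.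

Definition word_weight (w : multi) : weight n d :=
  exist (fun lam : {ffun 'I_n -> 'I_d.+1} => (\sum_k lam k == d)%N) _
    (word_weight_subproof w).

Lemma part_word_weight w k : part (word_weight w) k = content w k.
Proof. by rewrite /part /= ffunE. Qed.

Lemma sum_part (lam : weight n d) : (\sum_k part lam k = d)%N.
Proof. exact/eqP/(valP lam). Qed.

Lemma part_inj (lam mu : weight n d) : part lam =1 part mu -> lam = mu.
Proof. by move=> eq_part; apply/val_inj/ffunP => k; apply/val_inj/eq_part. Qed.

(** Both weights have sum [d], so neither can dominate the other in every part unless they agree. *)
Lemma part_lt_exists (lam mu : weight n d) :
  lam != mu -> exists k, (part lam k < part mu k)%N.
Proof.
move=> neq; apply/existsP; apply: contraR neq => /existsPn ge.
have le k : (part mu k <= part lam k)%N by rewrite leqNgt ge.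
have := sum_part lam; rewrite -{2}(sum_part mu) => eq_sum.
have : \sum_k (part lam k - part mu k)%N = 0%N by rewrite sumnB // eq_sum subnn.
move/eqP; rewrite sum_nat_eq0 => /forallP sub0; apply/eqP/part_inj => k.
by apply/eqP; rewrite eqn_leq le andbT -subn_eq0 (implyP (sub0 k)).
Qed.

Definition is_diag (x : T) (c : multi -> rat) :=
  forall t w, x t w = c w * t w.

Lemma is_diag_eq x y c : is_diag x c -> is_diag y c -> x = y.
Proof. by move=> xc yc; apply: tensor_endP => t w; rewrite xc yc. Qed.

Lemma is_diag_act k : is_diag (unit_act k k) (fun w => (content w k)%:R).
Proof.
move=> t w; rewrite unit_actE (eq_bigr (fun r => t w *+ (w r == k))) => [|r _].
  rewrite sumrMnr /content -sum1_card mulr_natl.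
  by congr (_ *+ _); rewrite [RHS]big_mkcond; apply: eq_bigr => r _; rewrite inE; case: (_ == _).
case: eqP => [eq_r|_]; last by rewrite !mulr0n.
by congr (t _ *+ _); apply/ffunP => s; rewrite ffunE; case: eqP => // ->.
Qed.

Lemma is_diag1 : is_diag 1 (fun _ => 1).
Proof. by move=> t w; rewrite tensor_end1 mul1r. Qed.

Lemma is_diagB x y c c' :
  is_diag x c -> is_diag y c' -> is_diag (x - y) (fun w => c w - c' w).
Proof. by move=> xc yc t w; rewrite add_lfunE opp_lfunE !ffunE xc yc mulrBl. Qed.

Lemma is_diagZ k x c : is_diag x c -> is_diag (k *: x) (fun w => k * c w).
Proof. by move=> xc t w; rewrite scale_lfunE ffunE xc -mulrA. Qed.

Lemma is_diag_nat k : is_diag k%:R (fun _ => k%:R).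
Proof.
move=> t w; elim: k => [|k IH]; first by rewrite zero_lfunE ffunE mul0r.
by rewrite !mulrS add_lfunE ffunE IH is_diag1 -mulrDl.
Qed.

Lemma is_diag_prod (J : Type) (s : seq J) (F : J -> T) c :
  (forall j, is_diag (F j) (c j)) ->
  is_diag (\prod_(j <- s) F j) (fun w => \prod_(j <- s) c j w).
Proof.
move=> Fc t w; elim: s t => [|j s IH] t; first by rewrite !big_nil tensor_end1 mul1r.
by rewrite !big_cons tensor_endM Fc IH mulrA.
Qed.

Lemma bin_prod (a m : nat) :
  m`!%:R^-1 * \prod_(j < m) (a%:R - j%:R) = 'C(a, m)%:R :> rat.
Proof.
have -> : \prod_(j < m) (a%:R - j%:R) = (a ^_ m)%:R :> rat.
  elim: m => [|m IH]; first by rewrite big_ord0.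
  rewrite big_ord_recr IH ffactnSr natrM /=; have [le_ma|lt_am] := leqP m a.
    by rewrite natrB.
  (* Subtraction in [nat] truncates here, but the falling factorial is already 0. *)
  by rewrite ffact_small // !mul0r.
rewrite -bin_ffact natrM mulrC mulfK //.
by rewrite Num.Theory.pnatr_eq0 -lt0n fact_gt0.
Qed.

(** The idempotent projects onto a weight space: at the weight [lam] all binomials are 1, and any
    other weight has a part below that of [lam], which gives a binomial 0. *)
Lemma is_diag_gen1 (lam : weight n d) :
  is_diag (gen_end (Gen1 lam)) (fun w => (lam == word_weight w)%:R).
Proof.
have -> : (fun w => (lam == word_weight w)%:R) =
  (fun w => \prod_k 'C(content w k, part lam k)%:R) :> (multi -> rat).
  apply: boolp.funext => w; have [->|neq] := eqVneq lam (word_weight w).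
    by rewrite big1 // => k _; rewrite part_word_weight binn.
  rewrite eq_sym in neq; have [k lt_k] := part_lt_exists neq.
  by rewrite (bigD1 k) //= bin_small ?mul0r // -part_word_weight.
apply: is_diag_prod => k t w.
rewrite -bin_prod gl_act_delta; move: t w; apply: is_diagZ.
apply: (@is_diag_prod _ _ _ (fun (j : 'I_(part lam k)) w =>
  (content w k)%:R - j%:R)) => j.
exact: (is_diagB (is_diag_act k) (is_diag_nat j)).
Qed.

End TensorAction.


Arguments gen_end : simpl never.

(** * Weight idempotents and weight shifts in the Schur algebra *)

Section WeightShift.

Context (n d : nat).
Local Notation multi := {ffun 'I_d -> 'I_n}.
Local Notation U := (@unit_act n d).
Local Notation one := (fun lam : weight n d => gen_end (Gen1 lam)).

Lemma weight_vec_inj : injective (@weight_vec n d).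
Proof.
move=> lam mu /rowP eq_v; apply: part_inj => k.
by have := eq_v k; rewrite !mxE => -[].
Qed.

Lemma content_upd (w : multi) r j k :
  (content (upd w r j) k + (w r == k) = content w k + (j == k))%N.
Proof.
have contentE (u : multi) : content u k = (\sum_s (u s == k))%N.
  rewrite /content -sum1_card big_mkcond; apply: eq_bigr => s _.
  by rewrite inE; case: (_ == _).
rewrite !contentE (bigD1 r) //= [in RHS](bigD1 r) //= ffunE eqxx.
rewrite -addnA addnC -addnA addnCA addnA; congr (_ + _ + _)%N.
by apply: eq_bigr => s neq_sr; rewrite ffunE (negPf neq_sr).
Qed.

Lemma weight_vec_upd (w : multi) r j :
  weight_vec (word_weight (upd w r j)) + delta_mx 0 (w r) =
  weight_vec (word_weight w) + delta_mx 0 j :> 'rV[int]_n.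
Proof.
apply/rowP => k; rewrite !mxE !part_word_weight eqxx /=.
have := content_upd w r j k; rewrite [k == w r]eq_sym [k == j]eq_sym.
by case: (w r == k); case: (j == k); rewrite ?addn0 ?addr0 //; lia.
Qed.

Lemma unit_gen1E i j lam t w : (U i j * one lam) t w =
  \sum_r (t (upd w r j) *+ (lam == word_weight (upd w r j))) *+ (w r == i).
Proof.
rewrite tensor_endM unit_actE; apply: eq_bigr => r _.
by rewrite is_diag_gen1 mulr_natl.
Qed.

Lemma gen1_unitE i j mu t w : (one mu * U i j) t w =
  \sum_r (t (upd w r j) *+ (mu == word_weight w)) *+ (w r == i).
Proof.
rewrite tensor_endM is_diag_gen1 mulr_natl unit_actE -sumrMnl.
by apply: eq_bigr => r _; rewrite -!mulrnA mulnC.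
Qed.

(** A contributing place has [w r = i]. Putting [j] there shifts the weight by a fixed vector, so
    both idempotents test the same condition. *)
Lemma unit_gen1_shift i j lam mu :
  weight_vec mu = weight_vec lam + delta_mx 0 i - delta_mx 0 j ->
  U i j * one lam = one mu * U i j.
Proof.
move=> eq_mu; apply: tensor_endP => t w; rewrite unit_gen1E gen1_unitE.
apply: eq_bigr => r _; case: (eqVneq (w r) i) => // eq_wr.
rewrite -(inj_eq weight_vec_inj) -[in RHS](inj_eq weight_vec_inj) eq_mu.
have := weight_vec_upd w r j; rewrite eq_wr => /(canRL (addrK _)) ->.
by rewrite subr_eq eq_sym subr_eq eq_sym.
Qed.

Lemma unit_gen1_eq0 i j lam :
  (forall mu : weight n d, weight_vec mu <> weight_vec lam + delta_mx 0 i - delta_mx 0 j) ->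
  U i j * one lam = 0.
Proof.
move=> no_mu; apply: tensor_endP => t w; rewrite unit_gen1E zero_lfunE ffunE.
apply: big1 => r _; case: (eqVneq (w r) i) => [eq_wr|//]; rewrite mulr1n.
case: eqP => // eq_lam; case: (no_mu (word_weight w)).
by rewrite eq_lam -eq_wr weight_vec_upd addrK.
Qed.

Lemma gen1_unit_eq0 i j mu :
  (forall lam : weight n d, weight_vec lam <> weight_vec mu - delta_mx 0 i + delta_mx 0 j) ->
  one mu * U i j = 0.
Proof.
move=> no_lam; apply: tensor_endP => t w; rewrite gen1_unitE zero_lfunE ffunE.
apply: big1 => r _; case: (eqVneq (w r) i) => [eq_wr|//]; rewrite mulr1n.
case: eqP => // eq_mu; case: (no_lam (word_weight (upd w r j))).
by rewrite eq_mu addrAC -(weight_vec_upd w r j) eq_wr addrK.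
Qed.

Lemma unit_act_diag k :
  U k k = \sum_(lam : weight n d) ((part lam k)%:R : rat) *: one lam.
Proof.
apply: (is_diag_eq (@is_diag_act n d k)) => t w.
rewrite sum_lfunE sum_ffunE (bigD1 (word_weight w)) //= [X in _ + X]big1 ?addr0.
  by rewrite scale_lfunE ffunE is_diag_gen1 eqxx mul1r part_word_weight.
move=> lam neq; rewrite scale_lfunE ffunE is_diag_gen1 (negPf neq) mul0r.
exact: mulr0.
Qed.

Lemma gen1_orthogonal lam mu :
  one lam * one mu = if lam == mu then one lam else 0.
Proof.
apply: tensor_endP => t w; rewrite tensor_endM !is_diag_gen1.
have [->|neq] := eqVneq lam mu.
  by rewrite is_diag_gen1; case: (_ == _); rewrite ?mul1r ?mul0r.
rewrite zero_lfunE ffunE; case: eqP => [eq_lam|_]; last by rewrite mul0r.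
by rewrite -eq_lam eq_sym (negPf neq) mul0r mulr0.
Qed.

Lemma gen1_complete : \sum_lam one lam = 1.
Proof.
apply: (is_diag_eq _ (@is_diag1 n d)) => t w.
rewrite sum_lfunE sum_ffunE (bigD1 (word_weight w)) //= [X in _ + X]big1 ?addr0.
  by rewrite is_diag_gen1 eqxx.
by move=> lam neq; rewrite is_diag_gen1 (negPf neq) mul0r.
Qed.

End WeightShift.

(** * Evaluation of the free algebra on operators *)

Section FreeEvaluation.

Context (X : choiceType) (n d : nat) (h : X -> tensor_end n d).
Local Notation T := (tensor_end n d).

Lemma tensor_end_scalerAl (k : rat) (x y : T) : k *: (x * y) = (k *: x) * y.
Proof. exact: comp_lfunZl. Qed.

Lemma tensor_end_scalerAr (k : rat) (x y : T) : k *: (x * y) = x * (k *: y).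
Proof. exact: comp_lfunZr. Qed.

Definition free_eval (v : free_alg X) : T :=
  \sum_(m <- msupp v) v@_m *: \prod_(x <- (m : seq X)) h x.

(** Lets two elements be summed over a common finite set of monomials. *)
Lemma free_evalEw (s : {fset fmonom X}) (v : free_alg X) :
  (msupp v `<=` s)%fset ->
  free_eval v = \sum_(m <- s) v@_m *: \prod_(x <- (m : seq X)) h x.
Proof.
by move=> le; apply: (big_fset_incl _ le) => //= m _ /mcoeff_outdom ->; rewrite scale0r.
Qed.

Fact free_eval_is_zmod_morphism : zmod_morphism free_eval.
Proof.
move=> u v; set s := (msupp u `|` msupp v)%fset.
rewrite !(@free_evalEw s) ?fsubsetUl ?fsubsetUr ?msuppB_le //.
by rewrite -sumrB; apply: eq_bigr => m _; rewrite raddfB scalerBl.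
Qed.
HB.instance Definition _ :=
  GRing.isZmodMorphism.Build (free_alg X) T free_eval free_eval_is_zmod_morphism.

Lemma free_evalB u v : free_eval (u - v) = free_eval u - free_eval v.
Proof. exact: raddfB. Qed.

Lemma free_evalD u v : free_eval (u + v) = free_eval u + free_eval v.
Proof. exact: raddfD. Qed.

Lemma free_eval0 : free_eval 0 = 0.
Proof. exact: raddf0. Qed.

Lemma free_evalU (c : rat) m :
  free_eval << c *g m >> = c *: \prod_(x <- (m : seq X)) h x.
Proof. by rewrite (free_evalEw msuppU_le) big_seq_fset1 mcoeffUU. Qed.

Lemma free_eval_letter x : free_eval (letter x) = h x.
Proof. by rewrite /letter free_evalU scale1r fmuE big_seq1. Qed.

Lemma free_evalM u v : free_eval (u * v) = free_eval u * free_eval v.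
Proof.
rewrite malgME raddf_sum mulr_suml; apply: eq_bigr => m _.
rewrite raddf_sum mulr_sumr; apply: eq_bigr => m' _.
rewrite /= free_evalU -tensor_end_scalerAl -tensor_end_scalerAr scalerA.
by congr (_ *: _); rewrite -big_cat; congr (\big[_/_]_(_ <- _) _); rewrite fmM.
Qed.

Lemma free_eval1 : free_eval 1 = 1.
Proof. by rewrite [1]/(<< 1 *g _ >>) free_evalU scale1r fm1 big_nil. Qed.

Lemma free_evalZ k v : free_eval (k *: v) = k *: free_eval v.
Proof.
rewrite (free_evalEw (msuppZ_le _ _)) scaler_sumr; apply: eq_bigr => m _.
by rewrite scalerA linearZ.
Qed.

End FreeEvaluation.


(** * The defining relations hold for the operators *)

Section Representation.

Context (n d : nat).
Local Notation P := (presented_alg n d).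
Local Notation T := (tensor_end n d).
Local Notation U := (@unit_act n d).
Local Notation ev := (free_eval (@gen_end n d)).

Lemma gen_end_e i : gen_end (GenE d i) = U (lo i) (hi i).
Proof. exact: gl_act_delta. Qed.

Lemma gen_end_f i : gen_end (GenF d i) = U (hi i) (lo i).
Proof. exact: gl_act_delta. Qed.

Lemma lo_eq (i j : 'I_n.-1) : (lo i == lo j) = (i == j).
Proof. by []. Qed.

Lemma hi_eq (i j : 'I_n.-1) : (hi i == hi j) = (i == j).
Proof. by []. Qed.

Lemma serreE (x y : T) :
  x ^+ 2 * y - 2 *: (x * y * x) + y * x ^+ 2 = lieb x (lieb x y).
Proof.
rewrite (scaler_nat 2) !expr2 !lieb_def !(mulrBl, mulrBr) !mulrA mulr2n; abelian.
Qed.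

Lemma hi_lo_eq (i j : 'I_n.-1) : (hi i == lo j) = (i.+1 == j :> nat).
Proof. by []. Qed.

Lemma lo_hi_eq (i j : 'I_n.-1) : (lo i == hi j) = (i == j.+1 :> nat).
Proof. by []. Qed.

Definition index_eqE := (lo_eq, hi_eq, hi_lo_eq, lo_hi_eq).

(** Two brackets with [U a b] could leave only [-2 U a b], and this only if [b = k] and [l = a]. *)
Lemma serre_unit_act a b k l : a != b -> ~~ ((b == k) && (l == a)) ->
  lieb (U a b) (lieb (U a b) (U k l)) = 0.
Proof.
move=> /negPf ab bkla; rewrite lieb_unit_act liebDr liebNr !liebMnr !lieb_unit_act.
rewrite [b == a]eq_sym ab; move: bkla.
by case: (b == k); case: (l == a) => // _; rewrite !(mulr0n, mulr1n); abelian.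
Qed.

Lemma schur_rel_eval l r : schur_rel l r -> ev l = ev r.
Proof.
have evM x y x' y' : ev x = x' -> ev y = y' -> ev (x * y) = x' * y'.
  by move=> <- <-; apply: free_evalM.
have evB x y x' y' : ev x = x' -> ev y = y' -> ev (x - y) = x' - y'.
  by move=> <- <-; apply: raddfB.
have evD x y x' y' : ev x = x' -> ev y = y' -> ev (x + y) = x' + y'.
  by move=> <- <-; apply: raddfD.
have evZ k x x' : ev x = x' -> ev (k *: x) = k *: x'.
  by move=> <-; apply: free_evalZ.
have evX2 x x' : ev x = x' -> ev (x ^+ 2) = x' ^+ 2.
  by move=> evx; apply: evM.
have ev0 : ev 0 = 0 by apply: raddf0.
have ev_sum (F : weight n d -> free_alg (generator n d)) :
  ev (\sum_lam F lam) = \sum_lam ev (F lam) by apply: raddf_sum.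
have ev1 lam : ev (free_1 lam) = gen_end (Gen1 lam) by apply: free_eval_letter.
have eve i : ev (free_e d i) = U (lo i) (hi i).
  by rewrite -gen_end_e; apply: free_eval_letter.
have evf i : ev (free_f d i) = U (hi i) (lo i).
  by rewrite -gen_end_f; apply: free_eval_letter.
have serre x y x' y' : ev x = x' -> ev y = y' ->
    ev (x ^+ 2 * y - 2 *: (x * y * x) + y * x ^+ 2) = lieb x' (lieb x' y').
  move=> evx evy; rewrite -serreE.
  have xyx := evM _ _ _ _ (evM _ _ _ _ evx evy) evx.
  have xxy := evM _ _ _ _ (evX2 _ _ evx) evy.
  exact: evD _ _ _ _ (evB _ _ _ _ xxy (evZ _ _ _ xyx)) (evM _ _ _ _ evy (evX2 _ _ evx)).
have comm x y x' y' : ev x = x' -> ev y = y' -> ev (x * y - y * x) = lieb x' y'.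
  move=> evx evy; rewrite lieb_def.
  exact: evB _ _ _ _ (evM _ _ _ _ evx evy) (evM _ _ _ _ evy evx).
have adjE (i j : 'I_n.-1) : adjacent i j = (i.+1 == j :> nat) || (j.+1 == i :> nat).
  by rewrite /adjacent; lia.
(* (S1) comes from the weight projections, (S2) from the weight shifts, and (S3) and the Serre
   relations from brackets of the [U i j]. *)
case=> [lam mu||i lam mu mu_E|i lam no_mu|i lam mu mu_E|i lam no_mu
       |i lam mu mu_E|i lam no_mu|i lam mu mu_E|i lam no_mu
       |i j|i j adj_ij|i j nadj|i j adj_ij|i j nadj].
- apply: etrans (evM _ _ _ _ (ev1 lam) (ev1 mu)) _; rewrite gen1_orthogonal.
  by case: eqP => _; apply: esym.
- apply: etrans (ev_sum _) (etrans _ (esym (free_eval1 _))).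
  by rewrite -gen1_complete; apply: eq_bigr => lam _; apply: ev1.
- apply: etrans (evM _ _ _ _ (eve i) (ev1 lam)) (etrans _ (esym (evM _ _ _ _ (ev1 mu) (eve i)))).
  by apply: unit_gen1_shift; rewrite mu_E /simple_root addrA.
- apply: etrans (evM _ _ _ _ (eve i) (ev1 lam)) (etrans _ (esym ev0)).
  by apply: unit_gen1_eq0 => mu; rewrite -addrA; apply: no_mu.
- apply: etrans (evM _ _ _ _ (evf i) (ev1 lam)) (etrans _ (esym (evM _ _ _ _ (ev1 mu) (evf i)))).
  by apply: unit_gen1_shift; rewrite mu_E /simple_root opprB addrA.
- apply: etrans (evM _ _ _ _ (evf i) (ev1 lam)) (etrans _ (esym ev0)).
  by apply: unit_gen1_eq0 => mu; rewrite -addrA -opprB; apply: no_mu.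
- apply: etrans (evM _ _ _ _ (ev1 lam) (eve i)) (etrans _ (esym (evM _ _ _ _ (eve i) (ev1 mu)))).
  by apply/esym/unit_gen1_shift; rewrite mu_E -addrA subrK.
- apply: etrans (evM _ _ _ _ (ev1 lam) (eve i)) (etrans _ (esym ev0)).
  by apply: gen1_unit_eq0 => mu; rewrite -addrA [- _ + _]addrC -opprB; apply: no_mu.
- apply: etrans (evM _ _ _ _ (ev1 lam) (evf i)) (etrans _ (esym (evM _ _ _ _ (evf i) (ev1 mu)))).
  by apply/esym/unit_gen1_shift; rewrite mu_E -addrA -opprB addrK.
- apply: etrans (evM _ _ _ _ (ev1 lam) (evf i)) (etrans _ (esym ev0)).
  by apply: gen1_unit_eq0 => mu; rewrite -addrA [- _ + _]addrC; apply: no_mu.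
- apply: etrans (comm _ _ _ _ (eve i) (evf j)) _.
  rewrite lieb_unit_act !index_eqE [j == i]eq_sym.
  case: (eqVneq i j) => [->|_]; last by rewrite subrr; apply: esym.
  apply: esym; apply: etrans (ev_sum _) _.
  rewrite !unit_act_diag -sumrB; apply: eq_bigr => lam _.
  by apply: etrans (evZ _ _ _ (ev1 lam)) _; rewrite scalerBl.
- apply: etrans (serre _ _ _ _ (eve i) (eve j)) (etrans _ (esym ev0)).
  by apply: serre_unit_act; rewrite !index_eqE; lia.
- apply: etrans (comm _ _ _ _ (eve i) (eve j)) _; apply: etrans _ (esym ev0).
  move: nadj; rewrite adjE negb_or => /andP[/negPf ij /negPf ji].
  by rewrite lieb_unit_act !index_eqE ij ji subrr.
- apply: etrans (serre _ _ _ _ (evf i) (evf j)) (etrans _ (esym ev0)).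
  by apply: serre_unit_act; rewrite !index_eqE; lia.
- apply: etrans (comm _ _ _ _ (evf i) (evf j)) _; apply: etrans _ (esym ev0).
  move: nadj; rewrite adjE negb_or => /andP[/negPf ij /negPf ji].
  by rewrite lieb_unit_act !index_eqE ![_ == _.+1 :> nat]eq_sym ij ji subrr.
Qed.

End Representation.


(** * The induced homomorphism to the Schur algebra *)

Section SchurMap.

Context (n d : nat).
Local Notation P := (presented_alg n d).
Local Notation T := (tensor_end n d).
Local Notation ev := (free_eval (@gen_end n d)).
Local Notation pi := (quot_pi (@schur_rel n d)).

Lemma ideal_eval x : two_sided_ideal (@schur_rel n d) x -> ev x = 0.
Proof.
elim=> [l r /schur_rel_eval lr||{}x y _ x0 _ y0|a {}x _ x0|a {}x _ x0].
- by apply: etrans (free_evalB _ _ _) _; rewrite lr subrr.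
- exact: free_eval0.
- by apply: etrans (free_evalD _ _ _) _; rewrite x0 y0 addr0.
- by apply: etrans (free_evalM _ _ _) _; rewrite x0 mulr0.
- by apply: etrans (free_evalM _ _ _) _; rewrite x0 mul0r.
Qed.

Lemma eval_pi x y : pi x = pi y -> ev x = ev y.
Proof.
move/quot_piP/ideal_eval => ev0; apply/eqP; rewrite -subr_eq0; apply/eqP.
by apply: etrans ev0; apply/esym/free_evalB.
Qed.

(** Evaluates a chosen representative; by [eval_pi] the choice does not matter. *)
Definition tensor_rep (q : P) : T := ev (repr q).

Lemma tensor_rep_pi x : tensor_rep (pi x) = ev x.
Proof. by apply: eval_pi; apply: reprK. Qed.

Fact tensor_rep_is_zmod_morphism : zmod_morphism tensor_rep.
Proof.
move=> p q; have [x <-] := quot_pi_surj p; have [y <-] := quot_pi_surj q.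
rewrite !tensor_rep_pi; transitivity (ev (x - y)); last exact: free_evalB.
by rewrite -tensor_rep_pi; congr tensor_rep; apply/esym/raddfB.
Qed.

Fact tensor_rep_is_monoid_morphism : monoid_morphism tensor_rep.
Proof.
split=> [|p q].
  have <- : pi 1 = 1 :> P by apply: rmorph1.
  by rewrite tensor_rep_pi; apply: free_eval1.
have [x <-] := quot_pi_surj p; have [y <-] := quot_pi_surj q.
rewrite !tensor_rep_pi; transitivity (ev (x * y)); last exact: free_evalM.
by rewrite -tensor_rep_pi; congr tensor_rep; apply/esym/rmorphM.
Qed.

HB.instance Definition _ :=
  GRing.isZmodMorphism.Build P T tensor_rep tensor_rep_is_zmod_morphism.
HB.instance Definition _ :=
  GRing.isMonoidMorphism.Build P T tensor_rep tensor_rep_is_monoid_morphism.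

Lemma tensor_rep_gen g : tensor_rep (gen_class g) = gen_end g.
Proof. by rewrite /gen_class tensor_rep_pi free_eval_letter. Qed.

Lemma place_permE (s : 'S_d) t w :
  place_perm_end n s t w = t [ffun r => w (s r)].
Proof. by rewrite lfunE ffunE. Qed.

(** A place permutation merely reindexes the sum over places. *)
Lemma unit_act_schur i j : unit_act d i j \in @schur_pred n d.
Proof.
apply/schur_predP => s; apply: tensor_endP => t w.
rewrite !tensor_endM place_permE !unit_actE (reindex_inj (@perm_inj _ s)).
apply: eq_bigr => r _; rewrite place_permE !ffunE; congr (t _ *+ _).
by apply/ffunP => q; rewrite !ffunE (inj_eq (@perm_inj _ s)).
Qed.

Lemma gen1_schur lam : gen_end (Gen1 lam) \in @schur_pred n d.
Proof.
apply/schur_predP => s; apply: tensor_endP => t w.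
rewrite !tensor_endM place_permE !is_diag_gen1 place_permE.
congr ((lam == _)%:R * _); apply: part_inj => k; rewrite !part_word_weight /content.
rewrite -!sum1_card (reindex_inj (@perm_inj _ s)).
by apply: eq_bigl => r; rewrite !inE ffunE.
Qed.

Lemma tensor_rep_schur q : tensor_rep q \in @schur_pred n d.
Proof.
have [x <-] := quot_pi_surj q; rewrite tensor_rep_pi; apply: rpred_sum => m _.
apply: rpredZ; apply: rpred_prod => -[lam|i|i] _.
- exact: gen1_schur.
- by rewrite gen_end_e; apply: unit_act_schur.
- by rewrite gen_end_f; apply: unit_act_schur.
Qed.

Definition schur_map (q : P) : schur n d :=
  @Defs.Schur n d (tensor_rep q) (tensor_rep_schur q).

Fact schur_map_is_zmod_morphism : zmod_morphism schur_map.
Proof. by move=> p q; apply: val_inj; apply: raddfB. Qed.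

Fact schur_map_is_monoid_morphism : monoid_morphism schur_map.
Proof. by split=> [|p q]; apply: val_inj; [apply: rmorph1|apply: rmorphM]. Qed.

HB.instance Definition _ :=
  GRing.isZmodMorphism.Build P (schur n d) schur_map schur_map_is_zmod_morphism.
HB.instance Definition _ :=
  GRing.isMonoidMorphism.Build P (schur n d) schur_map schur_map_is_monoid_morphism.

End SchurMap.


(** * Spanning the presented algebra *)

Lemma lmod_torsion_free (V : lmodType rat) (x : V) k : x *+ k.+1 = 0 -> x = 0.
Proof.
by move=> /eqP; rewrite -scaler_nat scaler_eq0 Num.Theory.pnatr_eq0 => /eqP.
Qed.

(** * Chevalley relations and matrix units in the presented algebra *)

Section PresentedRelations.

Context (n d : nat).
Local Notation P := (presented_alg n d).
Local Notation pi := (quot_pi (@schur_rel n d)).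

Definition pres_1 (lam : weight n d) : P := gen_class (Gen1 lam).
Definition pres_e (i : 'I_n.-1) : P := gen_class (GenE d i).
Definition pres_f (i : 'I_n.-1) : P := gen_class (GenF d i).
(** Stands for the diagonal matrix unit, which is not among the generators; differences of
    consecutive ones are the right sides of (S3). *)
Definition pres_h (k : 'I_n) : P := \sum_lam pres_1 lam *+ part lam k.

Local Notation one := pres_1.
Local Notation e := pres_e.
Local Notation f := pres_f.
Local Notation h := pres_h.

Lemma pi_rel l r : schur_rel l r -> pi l = pi r.
Proof. by move=> lr; apply/quot_piP/ideal_rel. Qed.

Let piM x y x' y' : pi x = x' -> pi y = y' -> pi (x * y) = x' * y'.
Proof. by move=> <- <-; apply: rmorphM. Qed.
Let piB x y x' y' : pi x = x' -> pi y = y' -> pi (x - y) = x' - y'.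
Proof. by move=> <- <-; apply: raddfB. Qed.
Let piD x y x' y' : pi x = x' -> pi y = y' -> pi (x + y) = x' + y'.
Proof. by move=> <- <-; apply: raddfD. Qed.
Let piZ k x x' : pi x = x' -> pi (k *: x) = k *: x'.
Proof. by move=> <-; apply: linearZ. Qed.
Let pi0 : pi 0 = 0. Proof. exact: raddf0. Qed.
Let pi_sum (F : weight n d -> free_alg (generator n d)) :
  pi (\sum_lam F lam) = \sum_lam pi (F lam).
Proof. exact: raddf_sum. Qed.
Let pi1 lam : pi (free_1 lam) = one lam. Proof. by []. Qed.
Let pie i : pi (free_e d i) = e i. Proof. by []. Qed.
Let pif i : pi (free_f d i) = f i. Proof. by []. Qed.

Lemma pres_1_orthogonal lam mu :
  one lam * one mu = if lam == mu then one lam else 0.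
Proof.
rewrite -(piM (pi1 lam) (pi1 mu)); apply: etrans (pi_rel (rel_idem_orthogonal lam mu)) _.
by case: eqP.
Qed.

Lemma pres_1_complete : \sum_lam one lam = 1.
Proof.
apply: etrans (esym (pi_sum _)) _; apply: etrans (pi_rel (rel_idem_complete n d)) _.
exact: rmorph1.
Qed.

Lemma pres_e_1 i lam mu : weight_vec mu = weight_vec lam + simple_root i ->
  e i * one lam = one mu * e i.
Proof.
move=> eq_mu; rewrite -(piM (pie i) (pi1 lam)) -(piM (pi1 mu) (pie i)).
exact/pi_rel/rel_e_idem.
Qed.

Lemma pres_e_1_eq0 i lam :
  (forall mu : weight n d, weight_vec mu <> weight_vec lam + simple_root i) ->
  e i * one lam = 0.
Proof.
move=> no_mu; rewrite -(piM (pie i) (pi1 lam)).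
by apply: etrans pi0; apply/pi_rel/rel_e_idem0.
Qed.

Lemma pres_f_1 i lam mu : weight_vec mu = weight_vec lam - simple_root i ->
  f i * one lam = one mu * f i.
Proof.
move=> eq_mu; rewrite -(piM (pif i) (pi1 lam)) -(piM (pi1 mu) (pif i)).
exact/pi_rel/rel_f_idem.
Qed.

Lemma pres_f_1_eq0 i lam :
  (forall mu : weight n d, weight_vec mu <> weight_vec lam - simple_root i) ->
  f i * one lam = 0.
Proof.
move=> no_mu; rewrite -(piM (pif i) (pi1 lam)).
by apply: etrans pi0; apply/pi_rel/rel_f_idem0.
Qed.

Let pi_lieb x y x' y' : pi x = x' -> pi y = y' -> pi (x * y - y * x) = lieb x' y'.
Proof.
by move=> ex ey; rewrite lieb_def; exact: piB (piM ex ey) (piM ey ex).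
Qed.

Let pi_serre x y x' y' : pi x = x' -> pi y = y' ->
  pi (x ^+ 2 * y - 2 *: (x * y * x) + y * x ^+ 2) = lieb x' (lieb x' y').
Proof.
move=> ex ey.
have pi_xy := piD (piB (piM (piM ex ex) ey) (piZ 2 (piM (piM ex ey) ex))) (piM ey (piM ex ex)).
apply: etrans pi_xy _.
rewrite (scaler_nat 2) !lieb_def !(mulrBl, mulrBr) !mulrA mulr2n; abelian.
Qed.

Lemma lieb_pres_ef i j :
  lieb (e i) (f j) = (h (lo i) - h (hi i)) *+ (i == j).
Proof.
apply: etrans (esym (pi_lieb (pie i) (pif j))) (etrans (pi_rel (rel_commutator d i j)) _).
case: (eqVneq i j) => [->|_]; last exact: pi0.
rewrite mulr1n -sumrB; apply: etrans (pi_sum _) _; apply: eq_bigr => lam _.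
by apply: etrans (piZ _ (pi1 lam)) _; rewrite scalerBl !scaler_nat.
Qed.

Lemma pres_e_serre i j : adjacent i j -> lieb (e i) (lieb (e i) (e j)) = 0.
Proof.
move=> adj_ij; rewrite -(pi_serre (pie i) (pie j)).
by apply: etrans pi0; apply/pi_rel/rel_e_serre.
Qed.

Lemma pres_e_comm i j : ~~ adjacent i j -> lieb (e i) (e j) = 0.
Proof.
move=> nadj; rewrite -(pi_lieb (pie i) (pie j)).
by apply: etrans pi0; apply/pi_rel/rel_e_commute.
Qed.

Lemma pres_f_serre i j : adjacent i j -> lieb (f i) (lieb (f i) (f j)) = 0.
Proof.
move=> adj_ij; rewrite -(pi_serre (pif i) (pif j)).
by apply: etrans pi0; apply/pi_rel/rel_f_serre.
Qed.

Lemma pres_f_comm i j : ~~ adjacent i j -> lieb (f i) (f j) = 0.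
Proof.
move=> nadj; rewrite -(pi_lieb (pif i) (pif j)).
by apply: etrans pi0; apply/pi_rel/rel_f_commute.
Qed.

Lemma pres_h_1 k lam : h k * one lam = one lam *+ part lam k.
Proof.
rewrite /pres_h mulr_suml (bigD1 lam) //= big1 ?addr0 => [|mu neq].
  by rewrite mulrnAl pres_1_orthogonal eqxx.
by rewrite mulrnAl pres_1_orthogonal (negPf neq) mul0rn.
Qed.

Lemma pres_1_h k lam : one lam * h k = one lam *+ part lam k.
Proof.
rewrite /pres_h mulr_sumr (bigD1 lam) //= big1 ?addr0 => [|mu neq].
  by rewrite mulrnAr pres_1_orthogonal eqxx.
by rewrite mulrnAr pres_1_orthogonal eq_sym (negPf neq) mul0rn.
Qed.

(** The idempotents sum to 1, so an equality may be tested on each weight separately. *)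
Lemma eq_pres_1 (x y : P) : (forall lam, x * one lam = y * one lam) -> x = y.
Proof.
move=> xy; rewrite -[x]mulr1 -[y]mulr1 -pres_1_complete !mulr_sumr.
exact: eq_bigr.
Qed.

Lemma lieb_pres_hh k l : lieb (h k) (h l) = 0.
Proof.
apply: eq_pres_1 => lam; rewrite lieb_def mulrBl mul0r -!mulrA !pres_h_1.
by rewrite !mulrnAr !pres_h_1 -!mulrnA mulnC subrr.
Qed.

(** If [x] carries weight [lam] to [mu], the bracket multiplies [x] by [part mu k - part lam k]; if
    there is no such [mu], both sides vanish on [lam]. *)
Lemma lieb_pres_shift k (x : P) (a b : 'I_n) :
  (forall lam mu, weight_vec mu = weight_vec lam + (delta_mx 0 a - delta_mx 0 b) ->
    x * one lam = one mu * x) ->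
  (forall lam,
     (forall mu : weight n d, weight_vec mu <> weight_vec lam + (delta_mx 0 a - delta_mx 0 b)) ->
    x * one lam = 0) ->
  lieb (h k) x = x *+ (k == a) - x *+ (k == b).
Proof.
move=> shift vanish; apply: eq_pres_1 => lam.
rewrite lieb_def !mulrBl !mulrnAl -!mulrA pres_h_1 mulrnAr.
have [mu /eqP eq_mu|no_mu] :=
  pickP [pred mu : weight n d | weight_vec mu == weight_vec lam + (delta_mx 0 a - delta_mx 0 b)].
  rewrite (shift lam mu) // mulrA pres_h_1 mulrnAl.
  apply/eqP; rewrite subr_eq addrAC eq_sym subr_eq -!mulrnDr; apply/eqP; congr (_ *+ _).
  have /rowP/(_ k) := eq_mu; rewrite !mxE eqxx /=.
  by case: (k == a); case: (k == b) => /=; lia.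
rewrite vanish ?mulr0 ?mul0rn ?subrr // => mu eq_mu.
by have := no_mu mu; rewrite /= eq_mu eqxx.
Qed.

Lemma lieb_pres_he k i : lieb (h k) (e i) = e i *+ (k == lo i) - e i *+ (k == hi i).
Proof. by apply: lieb_pres_shift; [apply: pres_e_1|apply: pres_e_1_eq0]. Qed.

Lemma lieb_pres_hf k i : lieb (h k) (f i) = f i *+ (k == hi i) - f i *+ (k == lo i).
Proof.
apply: lieb_pres_shift => [lam mu|lam]; rewrite -opprB.
  exact: pres_f_1.
exact: pres_f_1_eq0.
Qed.

Lemma sum_pres_h : \sum_k h k = d%:R.
Proof.
rewrite exchange_big /= -pres_1_complete -sumrMnl; apply: eq_bigr => lam _.
by rewrite sumrMnr sum_part.
Qed.

Definition extend0 m (F : 'I_m -> P) (k : nat) : P := oapp F 0 (insub k).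

Lemma extend0E m (F : 'I_m -> P) (i : 'I_m) : extend0 F i = F i.
Proof. by rewrite /extend0 valK. Qed.

Lemma extend0_ge m (F : 'I_m -> P) k : (m <= k)%N -> extend0 F k = 0.
Proof. by move=> le_mk; rewrite /extend0 insubF // ltnNge le_mk. Qed.

Lemma extend0P m (F : 'I_m -> P) k :
  (m <= k)%N /\ extend0 F k = 0 \/ exists2 i : 'I_m, k = i & extend0 F k = F i.
Proof.
have [le_mk|lt_km] := leqP m k; first by left; rewrite extend0_ge.
by right; exists (Ordinal lt_km); rewrite // -[k]/(val (Ordinal lt_km)) extend0E.
Qed.

Lemma chevalley_pres : chevalley n (extend0 e) (extend0 f) (extend0 h).
Proof.
have adjE (i j : 'I_n.-1) : adjacent i j = (i.+1 == j :> nat) || (j.+1 == i :> nat).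
  by rewrite /adjacent; lia.
have serre (F : 'I_n.-1 -> P) k l : (k.+1 == l) || (l.+1 == k) ->
    (forall i j, adjacent i j -> lieb (F i) (lieb (F i) (F j)) = 0) ->
    lieb (extend0 F k) (lieb (extend0 F k) (extend0 F l)) = 0.
  move=> kl serreF.
  have [[_ ->]|[i eq_k ->]] := extend0P F k; first by rewrite lieb0l.
  have [[_ ->]|[j eq_l ->]] := extend0P F l; first by rewrite !lieb0r.
  by apply: serreF; rewrite adjE -eq_k -eq_l.
have comm (F : 'I_n.-1 -> P) k l : k.+1 != l -> l.+1 != k ->
    (forall i j, ~~ adjacent i j -> lieb (F i) (F j) = 0) ->
    lieb (extend0 F k) (extend0 F l) = 0.
  move=> kl lk commF.
  have [[_ ->]|[i eq_k ->]] := extend0P F k; first by rewrite lieb0l.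
  have [[_ ->]|[j eq_l ->]] := extend0P F l; first by rewrite lieb0r.
  by apply: commF; rewrite adjE -eq_k -eq_l negb_or kl.
split.
- by move=> x; rewrite -mulr2n => /(@lmod_torsion_free P).
- move=> k l; have [[_ ->]|[i _ ->]] := extend0P h k; first by rewrite lieb0l.
  by have [[_ ->]|[j _ ->]] := extend0P h l; rewrite ?lieb0r ?lieb_pres_hh.
- move=> k l; have [[_ ->]|[i eq_l ->]] := extend0P e l; first by rewrite lieb0r !mul0rn subrr.
  have [[le_k ->]|[j eq_k ->]] := extend0P h k; last by rewrite lieb_pres_he eq_k eq_l.
  (* Here [k] is at least [n], while an existing generator has [i.+1 < n], so [k] is neither of its
     two positions. *)
  by rewrite lieb0l; have := ltn_ord i; case: eqP; case: eqP; rewrite ?subrr //; lia.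
- move=> k l; have [[_ ->]|[i eq_l ->]] := extend0P f l; first by rewrite lieb0r !mul0rn subrr.
  have [[le_k ->]|[j eq_k ->]] := extend0P h k; last by rewrite lieb_pres_hf eq_k eq_l.
  by rewrite lieb0l; have := ltn_ord i; case: eqP; case: eqP; rewrite ?subrr //; lia.
- move=> k l ltk ltl.
  have [[le_k _]|[i eq_k ->]] := extend0P e k; first by lia.
  have [[le_l _]|[j eq_l ->]] := extend0P f l; first by lia.
  rewrite lieb_pres_ef eq_k eq_l; congr ((_ - _) *+ _).
    by rewrite -[i : nat]/(lo i : nat) extend0E.
  by rewrite -[i.+1]/(hi i : nat) extend0E.
- by move=> k; apply: serre pres_e_serre; rewrite eqxx.
- by move=> k; apply: serre pres_e_serre; rewrite eqxx orbT.
- by move=> k l kl lk; apply: comm pres_e_comm.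
- by move=> k; apply: serre pres_f_serre; rewrite eqxx.
- by move=> k; apply: serre pres_f_serre; rewrite eqxx orbT.
- by move=> k l kl lk; apply: comm pres_f_comm.
Qed.

Definition pres_unit (i j : 'I_n) : P :=
  matrix_unit (extend0 e) (extend0 f) (extend0 h) i j.

Lemma lieb_pres_unit i j k l : lieb (pres_unit i j) (pres_unit k l) =
  pres_unit i l *+ (j == k) - pres_unit k j *+ (l == i).
Proof. exact: (lieb_matrix_unit chevalley_pres). Qed.

Lemma pres_unit_e i : pres_unit (lo i) (hi i) = e i.
Proof. by rewrite /pres_unit matrix_unit_e extend0E. Qed.

Lemma pres_unit_f i : pres_unit (hi i) (lo i) = f i.
Proof. by rewrite /pres_unit matrix_unit_f extend0E. Qed.

Lemma pres_unit_diag k : pres_unit k k = h k.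
Proof. by rewrite /pres_unit matrix_unit_diag extend0E. Qed.

End PresentedRelations.


(** * Words of length d span *)

Section Spanning.

Context (n d : nat).
Local Notation P := (presented_alg n d).
Local Notation E := (@pres_unit n d).
Local Notation one := (@pres_1 n d).
Local Notation h := (@pres_h n d).
Local Notation N := (normal E).
Local Notation word := (seq ('I_n * 'I_n)).
Local Notation diag s := [seq (k, k) | k <- s].

Lemma lsub_diag m k (s : seq 'I_n) :
  lsub k k (N m) (diag s) = N m (diag s) *+ count_mem k s.
Proof.
rewrite /lsub (@wsub_count _ _ _ _ _ _ (N m (diag s)) predT).
  rewrite count_map; congr (_ *+ _); apply: eq_count => l /=.
  by rewrite andbT eq_sym.
by move=> u [p q] v -> /= /eqP <-; rewrite mulr1n.
Qed.

(** On a weight the product acts by falling factorials: each repeated letter [(k, k)] meets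
    [part lam k] lowered by its earlier occurrences. The scalar is 0 once a letter occurs too
    often. *)
Lemma normal_diag_1 lam (s : seq 'I_n) : exists2 z : int,
  N (size s) (diag s) * one lam = one lam *~ z &
  z != 0 -> forall k, (count_mem k s <= part lam k)%N.
Proof.
elim: s => [|k s [z Nz z_le]]; first by exists 1 => //; rewrite mul1r mulr1z.
exists (z * ((part lam k)%:Z - (count_mem k s)%:Z)).
  rewrite /= lsub_diag pres_unit_diag mulrBl -mulrA mulrnAl Nz mulrzAr pres_h_1.
  by rewrite mulrBr mulrzBr !pmulrn -!mulrzA [X in _ *~ X - _]mulrC.
rewrite mulf_eq0 negb_or => /andP[/z_le le_s neq l].
rewrite /=; case: (eqVneq k l) => [<-|_]; last by rewrite add0n.
by rewrite add1n ltn_neqAle le_s andbT; apply: contraNneq neq => ->; rewrite subrr.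
Qed.

(** Only diagonal words need checking, and [d + 1] letters never fit into a weight of sum [d]. *)
Lemma normal_overfull w : N d.+1 w = 0.
Proof.
apply: (normal_vanish (@lieb_pres_unit n d) (@lmod_torsion_free _)) => s.
have [size_s|] := eqVneq (size s) d.+1; last by move=> ?; apply: normal_size; rewrite size_map.
apply: eq_pres_1 => lam; rewrite mul0r -size_s.
have [z -> z_le] := normal_diag_1 lam s.
have [->|/z_le le_s] := eqVneq z 0; first by rewrite mulr0z.
have : (size s <= d)%N.
  rewrite -(sum_part lam); apply: leq_trans (leq_sum _ (fun k _ => le_s k)).
  (* The multiplicities of the letters sum to the length of [s]. *)
  rewrite leq_eqVlt; apply/orP; left; apply/eqP; elim: s {size_s z_le le_s} => [|k s IH] /=.
    by rewrite big1.
  by rewrite big_split /= -IH (bigD1 k) //= eqxx big1 // => l /negPf neq; rewrite eq_sym neq.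
by rewrite size_s ltnn.
Qed.

Inductive normal_span : P -> Prop :=
| span0 : normal_span 0
| spanD x y : normal_span x -> normal_span y -> normal_span (x + y)
| spanZ (c : rat) x : normal_span x -> normal_span (c *: x)
| span_normal w : size w = d -> normal_span (N d w).

Lemma span_sum (J : Type) (s : seq J) (F : J -> P) :
  (forall j, normal_span (F j)) -> normal_span (\sum_(j <- s) F j).
Proof.
by move=> F_span; elim/big_rec: _ => [|j x _]; [apply: span0|apply: spanD].
Qed.

Lemma span_wsub b g (F : word -> P) w :
  (forall v, size v = size w -> normal_span (F v)) -> normal_span (wsub b g F w).
Proof.
elim: w F => [|x w IH] F F_span; first exact: span0.
apply: spanD; last by apply: IH => v eq_v; apply: F_span; rewrite /= eq_v.
by rewrite -scaler_nat; apply/spanZ/F_span.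
Qed.

(** Left multiplication is additive, and additive maps of rational vector spaces are linear. *)
Lemma pres_mulrZ (x y : P) (c : rat) : x * (c *: y) = c *: (x * y).
Proof. by apply: (@rat_linear P P ( *%R x)) => y1 y2; apply: mulrBr. Qed.

Lemma span_mull (x y : P) :
  (forall w, size w = d -> normal_span (x * N d w)) ->
  normal_span y -> normal_span (x * y).
Proof.
move=> xN; elim=> [|{}y z _ xy _ xz|c {}y _ xy|]; rewrite ?mulr0 ?mulrDr ?pres_mulrZ //.
- exact: span0.
- exact: spanD.
- exact: spanZ.
Qed.

(** With [k] letters missing, inserting [(i, i)] and summing over i multiplies the product by [k],
    which is invertible when positive. *)
Lemma span_short w k : (size w + k = d)%N -> normal_span (N (size w) w).
Proof.
elim: k w => [|k IH] w eq_d.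
  by rewrite addn0 in eq_d; rewrite {1}eq_d; apply: span_normal.
have := sum_normal E (size w) w.
under [\sum_i E i i]eq_bigr do rewrite pres_unit_diag.
rewrite sum_pres_h mulr_natl -mulrnBr; last by rewrite -[leqRHS]eq_d leq_addr.
rewrite (_ : (d - size w)%N = k.+1) -?scaler_nat; last by lia.
move/(congr1 ( *:%R k.+1%:R^-1)); rewrite scalerA mulVf ?Num.Theory.pnatr_eq0 // scale1r => <-.
by apply/spanZ/span_sum => i; apply: (IH ((i, i) :: w)); rewrite /= addSnnS.
Qed.

(** The vanishing of the product for [(i, j) :: w] rewrites [E i j * N d w] as a sum over words of
    the same length [d]. *)
Lemma span_unit i j y : normal_span y -> normal_span (E i j * y).
Proof.
apply: span_mull => w size_w.
have /(canRL (subrK _)) -> : E i j * N d w - lsub i j (N d) w = 0.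
  exact: (normal_overfull ((i, j) :: w)).
rewrite add0r; apply: span_wsub => v eq_v; apply: span_normal; exact: etrans size_w.
Qed.

(** Each [N d w] is an eigenvector of all [h k], with eigenvalue the number of letters in row [k];
    an idempotent therefore fixes or kills it. *)
Lemma span_1 lam y : normal_span y -> normal_span (one lam * y).
Proof.
apply: span_mull => w size_w.
pose c k := count (fun x : 'I_n * 'I_n => k == x.1) w.
have hN k : h k * N d w = N d w *+ c k.
  have /eqP := normal_overfull ((k, k) :: w).
  rewrite /= pres_unit_diag subr_eq0 => /eqP ->.
  rewrite /lsub (@wsub_count _ _ _ _ _ _ (N d w) predT).
    by congr (_ *+ _); apply: eq_count => x /=; rewrite andbT.
  by move=> u [p q] v -> /= /eqP <-; rewrite mulr1n.
(* Evaluating [one mu * h k * N d w] from either side yields two different multiples of the same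
   element. *)
have mismatch mu k : part mu k != c k -> one mu * N d w = 0.
  move=> neq; have : one mu * N d w *+ part mu k = one mu * N d w *+ c k.
    by rewrite -mulrnAl -pres_1_h -mulrA hN mulrnAr.
  rewrite -!scaler_nat => /eqP; rewrite -subr_eq0 -scalerBl scaler_eq0 => /orP[|/eqP //].
  by rewrite subr_eq0 Num.Theory.eqr_nat (negPf neq).
have [k neq|eq_c] := pickP [pred k | part lam k != c k].
  by rewrite (mismatch lam k neq); apply: span0.
suff -> : one lam * N d w = N d w by apply: span_normal.
rewrite -[RHS]mul1r -pres_1_complete mulr_suml (bigD1 lam) //= big1 ?addr0 // => mu neq_mu.
have [k neq|eq_mu] := pickP [pred k | part mu k != c k]; first exact: mismatch neq.
case/eqP: neq_mu; apply: part_inj => k.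
by have /negbFE/eqP -> := eq_mu k; have /negbFE/eqP -> := eq_c k.
Qed.

(** The span contains 1 and is stable under left multiplication by generators, hence contains every
    monomial. *)
Lemma normal_spanning x : normal_span x.
Proof.
have piZ c y : quot_pi (@schur_rel n d) (c *: y) = c *: quot_pi (@schur_rel n d) y.
  exact: linearZ.
have piM y z : quot_pi (@schur_rel n d) (y * z) =
  quot_pi (@schur_rel n d) y * quot_pi (@schur_rel n d) z by exact: rmorphM.
have [v <-] := quot_pi_surj x; rewrite [v]monalgE raddf_sum; apply: span_sum => m /=.
have -> : << v@_m *g m >> = v@_m *: << m >> :> free_alg (generator n d).
  by apply/malgP => m'; rewrite mcoeffZ !mcoeffU mulr_natr.
rewrite piZ; apply: spanZ; case: m => s.
elim: s => [|g s IH].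
  have <- : 1 = << FMonom [::] >> :> free_alg (generator n d) by rewrite -fmoneE.
  rewrite (_ : quot_pi _ _ = 1); last exact: rmorph1.
  (* The unit is the product of the empty word, with all [d] letters missing. *)
  exact: (@span_short [::] d).
have -> : << FMonom (g :: s) >> = letter g * << FMonom s >> :> free_alg (generator n d).
  by rewrite /letter [RHS]fgmulUU mulr1; congr mkmalgU; rewrite [RHS]fmmulE fmuE.
rewrite piM; case: g => [lam|i|i].
- exact: span_1.
- by have := @span_unit (lo i) (hi i) _ IH; rewrite pres_unit_e.
- by have := @span_unit (hi i) (lo i) _ IH; rewrite pres_unit_f.
Qed.

End Spanning.


(** * Matrix coefficients of normally ordered products *)

Section RepresentedUnits.

Context (n d : nat).
Local Notation U := (@unit_act n d).
Local Notation rep := (@tensor_rep n d).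

Lemma tensor_rep_lieb x y : rep (lieb x y) = lieb (rep x) (rep y).
Proof. by rewrite !lieb_def -!rmorphM; apply: raddfB. Qed.

Lemma tensor_rep_e (i j : 'I_n) : j = i.+1 :> nat ->
  rep (extend0 (@pres_e n d) i) = U i j.
Proof.
move=> eq_j; have lt_i : (i < n.-1)%N by have := ltn_ord j; lia.
rewrite -[i : nat]/(Ordinal lt_i : nat) extend0E tensor_rep_gen gen_end_e.
by congr (unit_act _ _ _); apply: val_inj.
Qed.

Lemma tensor_rep_f (i j : 'I_n) : j = i.+1 :> nat ->
  rep (extend0 (@pres_f n d) i) = U j i.
Proof.
move=> eq_j; have lt_i : (i < n.-1)%N by have := ltn_ord j; lia.
rewrite -[i : nat]/(Ordinal lt_i : nat) extend0E tensor_rep_gen gen_end_f.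
by congr (unit_act _ _ _); apply: val_inj.
Qed.

Lemma tensor_rep_h k : rep (pres_h d k) = U k k.
Proof.
rewrite unit_act_diag raddf_sum; apply: eq_bigr => lam _.
by rewrite scaler_nat raddfMn /= tensor_rep_gen.
Qed.

(** Off the diagonal both sides are the same iterated bracket of generators, by induction on the
    distance from the diagonal. *)
Lemma tensor_rep_unit i j : rep (pres_unit d i j) = U i j.
Proof.
rewrite /pres_unit; case: (order_split i j) => [[m]|eq_ij|[m]].
- move=> eq_j; rewrite eq_j matrix_unit_upper.
  elim: m j eq_j => [|m IH] j eq_j; first by apply: tensor_rep_e; rewrite eq_j addn1.
  have lt_k : (i + m.+1 < n)%N by have := ltn_ord j; lia.
  rewrite /= tensor_rep_lieb (IH (Ordinal lt_k)) //.
  rewrite (@tensor_rep_e (Ordinal lt_k) j) ?lieb_unit_act; last by rewrite eq_j addnS.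
  rewrite eqxx (_ : (j == i) = false) ?mulr1n ?subr0 //.
  by apply/eqP => /(congr1 val) /=; lia.
- by move/val_inj: eq_ij => ->; rewrite matrix_unit_diag extend0E tensor_rep_h.
- move=> eq_i; rewrite eq_i matrix_unit_lower.
  elim: m i eq_i => [|m IH] i eq_i; first by apply: tensor_rep_f; rewrite eq_i addn1.
  have lt_k : (j + m.+1 < n)%N by have := ltn_ord i; lia.
  rewrite /= lieb_converse tensor_rep_lieb (IH (Ordinal lt_k)) //.
  rewrite (@tensor_rep_f (Ordinal lt_k) i) ?lieb_unit_act; last by rewrite eq_i addnS.
  rewrite eqxx (_ : (j == i) = false) ?mulr1n ?subr0 //.
  by apply/eqP => /(congr1 val) /=; lia.
Qed.

Lemma tensor_rep_normal m w : rep (normal (pres_unit d) m w) = normal U m w.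
Proof.
rewrite (normal_morph _ _ _ (@tensor_rep_is_zmod_morphism n d)
  (@tensor_rep_is_monoid_morphism n d)).
by congr (normal _ m w); do 2 apply: boolp.funext => ?; apply: tensor_rep_unit.
Qed.

End RepresentedUnits.

(** * Placing letters in distinct tensor places *)

Section PlacedWords.

Context (n d : nat).
Local Notation T := (tensor_end n d).
Local Notation multi := {ffun 'I_d -> 'I_n}.
Local Notation letter := ('I_n * 'I_n)%type.
Local Notation p := (fun r (x : letter) => place r x.1 x.2).
Implicit Types (A : {set 'I_d}) (w : seq letter).

(** A place leaves [A] once it is used, so the sum runs over injective placements. *)
Fixpoint placed A w : T :=
  if w is x :: w' then \sum_(r in A) p r x * placed (A :\ r) w' else 1.

Lemma placed_swap A x y w : placed A (x :: y :: w) = placed A (y :: x :: w).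
Proof.
rewrite /=; under eq_bigr do rewrite mulr_sumr.
under [RHS]eq_bigr do rewrite mulr_sumr.
rewrite (exchange_big_dep (fun s => s \in A)) /= => [|r s _]; last by rewrite !inE => /andP[].
apply: eq_bigr => s sA.
rewrite (eq_bigl (fun r => r \in A :\ s)) => [|r]; last first.
  by rewrite !inE sA andbT andbC eq_sym.
apply: eq_bigr => r; rewrite !inE => /andP[neq_rs _].
rewrite !mulrA (place_comm _ _ _ _ neq_rs); congr (_ * placed _ w).
by rewrite !setDDl setUC.
Qed.

Lemma wsub_sum (J : finType) (V : zmodType) (Q : pred J) b g
    (F : J -> seq letter -> V) w :
  wsub b g (fun v => \sum_(j | Q j) F j v) w = \sum_(j | Q j) wsub b g (F j) w.
Proof.
elim: w F => [|x w IH] F /=; first by rewrite big1.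
by rewrite IH -sumrMnl -big_split.
Qed.

(** The new unit either meets a free place and becomes a further letter, or meets an occupied one
    and multiplies the letter there on the left. *)
Lemma unit_placed A i j w : (\sum_(r in A) place r i j) * placed A w =
  placed A ((i, j) :: w) + lsub i j (placed A) w.
Proof.
elim: w A => [|x w IH] A; first by rewrite /= mulr1 addr0; apply: eq_bigr => r _; rewrite mulr1.
rewrite placed_swap /lsub [placed A (x :: w)]/= [wsub _ _ _ _]/= mulr_sumr.
rewrite [wsub _ _ (fun v => \sum_(r in A) _) _]wsub_sum [placed A (x :: _ :: _)]/=.
rewrite -sumrMnl -!big_split /=; apply: eq_bigr => r rA.
rewrite (@wsub_morph _ _ _ ( *%R (place r x.1 x.2))) ?mulr0 //; last exact: mulrDr.
rewrite addrCA -mulrDr -[X in _ * (X + _)]/(placed _ ((i, j) :: w)) -IH.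
rewrite (bigD1 r) //= mulrDl; congr (_ + _).
  by rewrite mulrA placeM mulrnAl.
rewrite !mulrA mulr_sumr; congr (_ * _); rewrite mulr_suml.
rewrite (eq_bigl (fun s => s \in A :\ r)) => [|s]; last by rewrite !inE andbC.
by apply: eq_bigr => s; rewrite !inE => /andP[neq_sr _]; apply: place_comm.
Qed.

Lemma normal_placed w : normal (@unit_act n d) (size w) w = placed setT w.
Proof.
elim: {w}(size w) {-2}w (erefl (size w)) => [|m IH] [|[i j] w] //= [eq_m].
rewrite IH // (_ : unit_act d i j = \sum_(r in [set: 'I_d]) place r i j); last first.
  by apply: eq_bigl => r; rewrite inE.
rewrite unit_placed /= -addrA [X in _ + X](_ : _ = 0) ?addr0 //.
apply/eqP; rewrite subr_eq0; apply/eqP/esym/eq_wsub => v eq_v.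
by rewrite -eq_v; apply: IH; rewrite eq_v.
Qed.

Definition basis_tensor (v : multi) : tensor n d := [ffun w : multi => (w == v)%:R].

Definition coef (x : T) (u v : multi) : rat := x (basis_tensor v) u.

Lemma coef_inj x y : (forall u v, coef x u v = coef y u v) -> x = y.
Proof.
move=> eq_xy; apply: tensor_endP => t u.
have -> : t = \sum_v (t v : rat) *: basis_tensor v.
  apply/ffunP => w; rewrite sum_ffunE (bigD1 w) //= big1 ?addr0 => [|v neq].
    by rewrite !ffunE eqxx; rewrite /GRing.scale /= mulr1.
  by rewrite !ffunE eq_sym (negPf neq); apply: mulr0.
rewrite !linear_sum !sum_ffunE; apply: eq_bigr => v _.
by rewrite !linearZ !ffunE; congr (_ *: _); apply: eq_xy.
Qed.

(** The number of permutations of the positions that fix the word [w]. *)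
Definition word_mult w : nat := \prod_(x : letter) (count_mem x w)`!.

Lemma word_mult_cons x w : word_mult (x :: w) = ((count_mem x w).+1 * word_mult w)%N.
Proof.
rewrite /word_mult (bigD1 x) //= [in RHS](bigD1 x) //= eqxx add1n factS mulnA.
congr (_ * _)%N; apply: eq_bigr => y neq.
by rewrite eq_sym (negPf neq).
Qed.

Lemma word_mult_perm w w' : perm_eq w w' -> word_mult w = word_mult w'.
Proof. by move=> /seq.permP eq_w; apply: eq_bigr => x _; rewrite eq_w. Qed.

Lemma coef_placed A w u v : #|A| = size w ->
  coef (placed A w) u v =
  (word_mult w * ([forall r, (r \notin A) ==> (u r == v r)]
     && perm_eq w [seq (u r, v r) | r <- enum A]))%:R.
Proof.
rewrite /coef; elim: w A u => [|[i j] w IH] A u /=.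
  move/eqP; rewrite cards_eq0 => /eqP ->.
  rewrite tensor_end1 ffunE enum_set0 /= andbT /word_mult big1 //.
  rewrite mul1n; congr _%:R; congr (nat_of_bool _).
  apply/eqP/forallP => [-> r|eq_uv]; first by rewrite eqxx implybT.
  by apply/ffunP => r; have := eq_uv r; rewrite inE => /eqP.
move=> card_A; set off := [forall r, _]; set z := fun r => (u r, v r).
(* Splits by the place of the first letter, which must satisfy [z r = (i, j)]. *)
transitivity (\sum_(r in A) ((z r == (i, j)) * (off * perm_eq ((i, j) :: w) (map z (enum A)))
    * word_mult w)%:R : rat).
  rewrite sum_lfunE sum_ffunE; apply: eq_bigr => r rA.
  rewrite tensor_endM placeE IH; last by have := cardsD1 r A; rewrite rA card_A => -[].
  have -> : [forall s, (s \notin A :\ r) ==> (upd u r j s == v s)] = off && (v r == j).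
    apply/forallP/andP => [eq_uv|[/forallP eq_uv /eqP eq_j] s]; last first.
      rewrite !inE negb_and negbK ffunE; have [->|_] := eqVneq s r; first by rewrite eq_j eqxx.
      exact: eq_uv.
    split; last by have := eq_uv r; rewrite !inE eqxx ffunE eqxx eq_sym.
    apply/forallP => s; apply/implyP => sA; have := eq_uv s.
    rewrite !inE (negPf sA) andbF ffunE; case: (eqVneq s r) => // eq_sr.
    by rewrite eq_sr rA in sA.
  have -> : [seq (upd u r j s, v s) | s <- enum (A :\ r)] = map z (enum (A :\ r)).
    by apply/eq_in_map => s; rewrite mem_enum !inE ffunE => /andP[/negPf ->].
  have perm_A : perm_eq (map z (enum A)) (z r :: map z (enum (A :\ r))).
    rewrite -map_cons perm_map // uniq_perm ?enum_uniq //=.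
      by rewrite enum_uniq mem_enum !inE eqxx.
    by move=> s; rewrite inE !mem_enum !inE; case: (eqVneq s r) => // ->.
  rewrite (permPr perm_A) xpair_eqE.
  have [<-|_] := eqVneq (u r) i; last by rewrite mulr0n !mul0n.
  have [<-|_] := eqVneq (v r) j; last by rewrite !andbF muln0 !mul0n.
  rewrite perm_cons andbT mul1n mulr1n.
  by case: off; case: (perm_eq _ _); rewrite ?mul1n ?mul0n ?muln1 ?muln0.
rewrite -natr_sum -!big_distrl /=; congr _%:R.
have [perm_w|_] := boolP (perm_eq _ _); last by rewrite andbF !muln0 mul0n.
rewrite andbT muln1; case: off; last by rewrite !muln0 mul0n.
rewrite !muln1 word_mult_cons; congr (_ * _)%N.
have := seq.permP perm_w (pred1 (i, j)); rewrite /= eqxx add1n => ->.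
rewrite count_map -sum1_count big_enum_cond /=.
by rewrite [RHS]big_mkcondr; apply: eq_bigr => r _; case: (_ == _).
Qed.

End PlacedWords.


(** * The inverse map from matrix coefficients *)

Section Inverse.

Context (n d : nat).
Local Notation P := (presented_alg n d).
Local Notation T := (tensor_end n d).
Local Notation multi := {ffun 'I_d -> 'I_n}.
Local Notation letter := ('I_n * 'I_n)%type.
Local Notation N := (normal (pres_unit d) d).
Local Notation rep := (@tensor_rep n d).
Implicit Types (w z : d.-tuple letter) (x y : T).

Definition rows w : multi := [ffun r => (tnth w r).1].
Definition cols w : multi := [ffun r => (tnth w r).2].

Definition pair_word (u v : multi) : d.-tuple letter := [tuple (u r, v r) | r < d].

Lemma rows_pair_word u v : rows (pair_word u v) = u.
Proof. by apply/ffunP => r; rewrite ffunE tnth_mktuple. Qed.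

Lemma cols_pair_word u v : cols (pair_word u v) = v.
Proof. by apply/ffunP => r; rewrite ffunE tnth_mktuple. Qed.

Lemma coef_normal w z :
  coef (rep (N w)) (rows z) (cols z) = (word_mult w * perm_eq w z)%:R.
Proof.
rewrite tensor_rep_normal -[X in normal _ X](size_tuple w) normal_placed.
rewrite coef_placed ?cardsT ?card_ord ?size_tuple //.
have -> : [forall r, (r \notin [set: 'I_d]) ==> (rows z r == cols z r)].
  by apply/forallP => r; rewrite inE.
rewrite enum_setT -enumT (eq_map (g := tnth z)) ?map_tnth_enum // => r.
by rewrite !ffunE -surjective_pairing.
Qed.

(** Commuting with place permutations makes the matrix coefficients constant on orbits of pairs of
    multi-indices. *)
Lemma coef_schur x w z : x \in @schur_pred n d -> perm_eq w z ->
  coef x (rows w) (cols w) = coef x (rows z) (cols z).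
Proof.
move=> /schur_predP x_schur; rewrite perm_sym => /tuple_permP[s /val_inj ->].
(* The mixed coefficient, with the rows of [w] and the permuted columns, moves the permutation onto
   the column index on one side and onto the row index on the other. *)
have := congr1 (fun y : T => coef y (rows w) (cols [tuple tnth w (s i)  | i < d])) (x_schur s).
rewrite /coef !tensor_endM place_permE.
have -> : place_perm_end n s (basis_tensor (cols [tuple tnth w (s i)  | i < d])) =
          basis_tensor (cols w).
  apply/ffunP => u; rewrite place_permE !ffunE; congr (nat_of_bool _)%:R.
  apply/eqP/eqP => [/ffunP eq_u|->]; apply/ffunP => r.
    by have := eq_u ((s^-1)%g r); rewrite !ffunE tnth_mktuple permKV.
  by rewrite !ffunE tnth_mktuple.
move=> ->; congr (x _ _); apply/ffunP => r.
by rewrite !ffunE tnth_mktuple.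
Qed.

Definition perm_class w := #|[pred z : d.-tuple letter | perm_eq w z]|.

(** Cancels two factors: the coefficient [word_mult w] of [N w], and the repetition of its class
    [perm_class w] times in a sum over tuples. *)
Definition class_weight w : rat := (word_mult w * perm_class w)%:R^-1.

Lemma perm_class_gt0 w : (0 < perm_class w)%N.
Proof. by apply/card_gt0P; exists w; rewrite inE. Qed.

Lemma class_weight_perm w z : perm_eq w z -> class_weight w = class_weight z.
Proof.
move=> eq_wz; rewrite /class_weight (word_mult_perm eq_wz); congr ((_ * _)%:R^-1).
by apply: eq_card => t; rewrite !inE (permPl eq_wz).
Qed.

Lemma sum_class_weight (V : lmodType rat) w (t : V) :
  \sum_(z : d.-tuple letter | perm_eq w z) (class_weight w * (word_mult w)%:R) *: t = t.
Proof.
rewrite sumr_const -scaler_nat scalerA /class_weight natrM invfM.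
have mult_neq0 : (word_mult w)%:R != 0 :> rat.
  rewrite Num.Theory.pnatr_eq0 -lt0n /word_mult prodn_gt0 // => x.
  exact: fact_gt0.
rewrite mulrAC mulVf // mul1r divff ?scale1r //.
by rewrite Num.Theory.pnatr_eq0 -lt0n perm_class_gt0.
Qed.

(** Summing over all tuples, with weights, avoids choosing one representative for each multiset of
    letters. *)
Definition schur_inverse (x : T) : P :=
  \sum_(w : d.-tuple letter) (class_weight w * coef x (rows w) (cols w)) *: N w.

Lemma tensor_repZ (c : rat) (p : P) : rep (c *: p) = c *: rep p.
Proof. exact: (rat_linear (@tensor_rep_is_zmod_morphism n d)). Qed.

Lemma schur_inverseK x : x \in @schur_pred n d -> rep (schur_inverse x) = x.
Proof.
move=> x_schur; apply: coef_inj => u v.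
rewrite -(rows_pair_word u v) -{2 4}(cols_pair_word u v).
move: (pair_word u v) => z.
rewrite /coef raddf_sum sum_lfunE sum_ffunE.
rewrite -[RHS](@sum_class_weight rat^o z) [RHS]big_mkcond; apply: eq_bigr => w _.
rewrite /= tensor_repZ scale_lfunE ffunE.
rewrite -[rep _ _ _]/(coef _ _ _) -[x _ _]/(coef _ _ _) coef_normal.
rewrite perm_sym; have [eq_zw|_] := boolP (perm_eq z w); last by rewrite muln0; apply: mulr0.
rewrite muln1 (class_weight_perm eq_zw) (word_mult_perm eq_zw) (coef_schur x_schur eq_zw).
by rewrite /GRing.scale /= mulrAC.
Qed.

Lemma schur_inverse_normal w : schur_inverse (rep (N w)) = N w.
Proof.
rewrite /schur_inverse -[RHS](sum_class_weight w) [RHS]big_mkcond.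
apply: eq_bigr => z _; rewrite coef_normal.
have [eq_wz|_] := boolP (perm_eq w z); last by rewrite muln0 mulr0 scale0r.
rewrite muln1 -(class_weight_perm eq_wz); congr (_ *: _).
by apply/esym/normal_perm => //; apply: lieb_pres_unit.
Qed.

Lemma schur_inverseD x y : schur_inverse (x + y) = schur_inverse x + schur_inverse y.
Proof.
rewrite /schur_inverse -big_split; apply: eq_bigr => w _ /=.
by rewrite -scalerDl -mulrDr /coef add_lfunE ffunE.
Qed.

Lemma schur_inverseZ c x : schur_inverse (c *: x) = c *: schur_inverse x.
Proof.
rewrite /schur_inverse scaler_sumr; apply: eq_bigr => w _ /=.
by rewrite scalerA mulrCA /coef scale_lfunE ffunE.
Qed.

(** Both maps are linear and the [N w] span, so the identity is needed on the [N w] only. *)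
Lemma tensor_repK (p : P) : schur_inverse (rep p) = p.
Proof.
elim: (normal_spanning p) => [|q1 q2 _ IH1 _ IH2|c q _ IH|w size_w].
- by rewrite raddf0 -(scale0r 0) schur_inverseZ scale0r.
- by rewrite raddfD schur_inverseD IH1 IH2.
- by rewrite tensor_repZ schur_inverseZ IH.
- exact: (schur_inverse_normal (Tuple (introT eqP size_w))).
Qed.

End Inverse.

Theorem theorem4 (n d : nat) (hn : (1 <= n)%N) (hd : (1 <= d)%N) :
  exists phi : {rmorphism presented_alg n d -> schur n d},
    [/\ bijective phi,
        forall (c : rat) (x : presented_alg n d), phi (c *: x) = c *: phi x &
        forall g : generator n d, schur_val (phi (gen_class g)) = gen_end g].
Proof.
exists (@schur_map n d); split=> [|c x|g].
- exists (fun x => schur_inverse (schur_val x)) => x; first exact: tensor_repK.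
  by apply: val_inj; apply: schur_inverseK; apply: schur_valP.
- by apply: val_inj; apply: tensor_repZ.
- exact: tensor_rep_gen.
Qed.
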